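(* Let $\omega\in\mathbb{R}^{n+1}$ be a fixed unit vector and let $\mathbf{F}:M^n\times[0,T]\to\mathbb{R}^{n+1}$ be a smooth solution of mean curvature flow $$\frac{d}{dt}\mathbf{F}(p,t)=\mathbf{H}(p,t)$$ which is a graph over a ball $B_R(0)$ in the hyperplane orthogonal to $\omega$, with height bound $|u|<M$. Then there are constants $q>1$, $c>0$ and $T'>0$, depending on $M$ and $R$, such that $$v\le t^{q/2}\exp\!\left(\frac{cq(u+2M)^2}{4t}\right)\left(R^2-2nt-|\mathbf{x}|^2+u^2\right)^{-1}$$ for $0<t\le T'$ (with $t\le T$), at all points where $R^2-2nt-|\mathbf{x}|^2+u^2>0$.
   Context: $\mathbf{H}$ is the mean curvature vector. For the image point $\mathbf{x}=\mathbf{F}(p,t)$, the height is $u=\langle\mathbf{x},\omega\rangle$, and the gradient function is $v=\langle\nu,\omega\rangle^{-1}=\sqrt{1+|Du|^2}$, where $\nu$ is the unit normal with $\langle\nu,\omega\rangle>0$. Note $|\mathbf{x}|^2-u^2$ is the squared norm of the projection of $\mathbf{x}$ to the hyperplane. *)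

(* Defs.v *)
From HB Require Import structures.
From mathcomp Require Import all_boot all_order all_algebra.
From mathcomp Require Import all_classical all_reals all_analysis.

Set Implicit Arguments.
Unset Strict Implicit.
Unset Printing Implicit Defensive.

Import Order.TTheory GRing.Theory Num.Theory.
Import numFieldNormedType.Exports.

Local Open Scope classical_set_scope.
Local Open Scope ring_scope.

(* The norm that the library puts on 'rV[R]_n is the sup norm; it induces the
   usual topology, but lengths are measured with [dotv]. *)
Definition dotv {R : realType} {n : nat} (x y : 'rV[R]_n) : R :=
  \sum_(i < n) x 0 i * y 0 i.

(* For an open set [A] of a finite-dimensional space this is C^k regularity:
   directional derivatives in all directions, up to order k, exist and are
   continuous on [A]. *)
Fixpoint Ck {R : realType} {V W : normedModType R} (k : nat) (A : set V)
    (f : V -> W) : Prop :=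
  (forall x, A x -> {for x, continuous f}) /\
  match k with
  | 0%N => True
  | k'.+1 => forall v : V, (forall x, A x -> derivable f x v) /\
                           Ck k' A (fun x => 'D_v f x)
  end.

(* Smoothness on an arbitrary subset: local extendability to smooth functions
   on open sets.  On products with the closed interval [0, T] this is
   smoothness up to the endpoints. *)
Definition smooth_on {R : realType} {V W : normedModType R} (A : set V)
    (f : V -> W) : Prop :=
  forall x, A x -> exists (U : set V) (g : V -> W),
    [/\ open U, U x, (forall k, Ck k U g) & forall y, A y -> U y -> g y = f y].

(* The values of [to_coord] off [chart_dom] and of [of_coord] off
   [chart_img] are irrelevant. *)
Record chart (R : realType) (n : nat) (X : topologicalType) := Chart {
  chart_dom : set X;
  to_coord : X -> 'rV[R]_n;
  of_coord : 'rV[R]_n -> X }.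

Definition chart_img {R : realType} {n : nat} {X : topologicalType}
  (c : chart R n X) : set 'rV[R]_n := to_coord c @` chart_dom c.

Definition is_chart {R : realType} {n : nat} {X : topologicalType}
    (c : chart R n X) : Prop :=
  [/\ open (chart_dom c), open (chart_img c),
      forall p, chart_dom c p -> of_coord c (to_coord c p) = p,
      forall p, chart_dom c p -> {for p, continuous (to_coord c)}
    & forall z, chart_img c z -> {for z, continuous (of_coord c)}].

Record smooth_manifold (R : realType) (n : nat) := SmoothManifold {
  mfd_space :> topologicalType;
  atlas : set (chart R n mfd_space);
  mfd_hausdorff : hausdorff_space mfd_space;
  mfd_second_countable : @second_countable mfd_space;
  atlas_chart : forall c, atlas c -> is_chart c;
  atlas_cover : forall p, exists2 c, atlas c & chart_dom c p;
  atlas_compat : forall c d, atlas c -> atlas d ->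
    smooth_on (to_coord c @` (chart_dom c `&` chart_dom d))
              (fun z => to_coord d (of_coord c z)) }.

Section LocalGeometry.
Variables (R : realType) (n : nat) (X : 'rV[R]_n -> 'rV[R]_n.+1).

Definition partial (i : 'I_n) (Y : 'rV[R]_n -> 'rV[R]_n.+1) (z : 'rV[R]_n) :
  'rV[R]_n.+1 := 'D_(delta_mx 0 i) Y z.

(* row i is the coordinate tangent vector d_i X *)
Definition tangent_mx (z : 'rV[R]_n) : 'M[R]_(n, n.+1) :=
  \matrix_(i < n) partial i X z.

Definition metric_mx (z : 'rV[R]_n) : 'M[R]_n :=
  tangent_mx z *m (tangent_mx z)^T.

Definition normal_part (z : 'rV[R]_n) (w : 'rV[R]_n.+1) : 'rV[R]_n.+1 :=
  w - w *m (tangent_mx z)^T *m invmx (metric_mx z) *m tangent_mx z.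

(* g^{ij} (d_i d_j X)^perp, the (unnormalised) trace of the second
   fundamental form *)
Definition mean_curvature_vector (z : 'rV[R]_n) : 'rV[R]_n.+1 :=
  \sum_(i < n) \sum_(j < n)
    invmx (metric_mx z) i j *: normal_part z (partial i (partial j X) z).

End LocalGeometry.

Definition in_chart {R : realType} {n : nat} {Mn : smooth_manifold R n}
    (c : chart R n Mn) (f : Mn -> 'rV[R]_n.+1) : 'rV[R]_n -> 'rV[R]_n.+1 :=
  fun z => f (of_coord c z).

Definition immersion {R : realType} {n : nat} {Mn : smooth_manifold R n}
    (f : Mn -> 'rV[R]_n.+1) : Prop :=
  forall c p, atlas c -> chart_dom c p ->
    row_free (tangent_mx (in_chart c f) (to_coord c p)).

(* The time derivative is taken within [0, T], hence is one-sided at the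
   endpoints. *)
Definition smooth_mcf {R : realType} {n : nat} {Mn : smooth_manifold R n}
    (T : R) (F : Mn -> R -> 'rV[R]_n.+1) : Prop :=
  [/\ forall c : chart R n Mn, atlas c ->
        smooth_on (chart_img c `*` [set t : R | 0 <= t <= T])
                  (fun z : 'rV[R]_n * R => F (of_coord c z.1) z.2),
      forall t, 0 <= t <= T -> immersion (fun p => F p t)
    & forall c p t, atlas c -> chart_dom c p -> 0 <= t <= T ->
        (s - t)^-1 *: (F p s - F p t)
          @[s --> within [set s : R | 0 <= s <= T] t^'] -->
        mean_curvature_vector (in_chart c (fun p => F p t)) (to_coord c p)].

Definition hyperplane_proj {R : realType} {n : nat} (w x : 'rV[R]_n) :
  'rV[R]_n := x - dotv x w *: w.

Definition hyperplane_ball {R : realType} {n : nat} (w : 'rV[R]_n) (r : R) :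
  set 'rV[R]_n := [set y | dotv y w = 0 /\ dotv y y < r ^+ 2].

(* For each t in [0, T], the part of F(Mn, t) lying over the ball is the graph
   of u(., t), where u is smooth in space and time. *)
Definition graph_over_ball {R : realType} {n : nat} {Mn : smooth_manifold R n}
    (w : 'rV[R]_n.+1) (r T : R) (F : Mn -> R -> 'rV[R]_n.+1)
    (u : 'rV[R]_n.+1 -> R -> R) : Prop :=
  smooth_on (hyperplane_ball w r `*` [set t : R | 0 <= t <= T])
            (fun z : 'rV[R]_n.+1 * R => u z.1 z.2 : R^o) /\
  forall t, 0 <= t <= T ->
    range (fun p => F p t) `&`
      [set x | hyperplane_ball w r (hyperplane_proj w x)] =
    [set y + u y t *: w | y in hyperplane_ball w r].

Definition upward_unit_normal {R : realType} {n : nat}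
    {Mn : smooth_manifold R n} (w : 'rV[R]_n.+1) (f : Mn -> 'rV[R]_n.+1)
    (p : Mn) (nu : 'rV[R]_n.+1) : Prop :=
  [/\ dotv nu nu = 1, 0 < dotv nu w
    & forall c, atlas c -> chart_dom c p ->
        tangent_mx (in_chart c f) (to_coord c p) *m nu^T = 0].

(* Main.v *)
(** Write [phi(h, t) = t exp((h + 2 M)^2 / (2 t))], i.e. [q = 2] and [c = 1].
    As a graph over the hyperplane, the flow is a solution [u] of
    [u_t = a_ij(Du) u_ij] with [a = 1 - Du Du^T / v^2] and [v^2 = 1 + |Du|^2].
    On a slightly smaller ball let [v eta / phi], where
    [eta = r^2 - 2 n t - |y|^2], attain a maximum larger than 1; this happens at
    a positive time since [phi] blows up as [t -> 0], and inside the ball since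
    [eta <= 0] on its boundary.  Let [p] be the value of [Du] at that point.
    By Cauchy-Schwarz [1 + p . Du <= v(p) v], with equality at the point, so
    [ln (1 + p . Du) + ln eta - ln phi] has a local maximum there as well.
    Differentiating the equation in the fixed direction [p], the first and second
    derivative tests contradict each other once [t] is small in terms of [M] and
    [r]; the dimension drops out because [eta] contains the term [- 2 n t]. *)

From HB Require Import structures.
Require Import Defs.
From mathcomp Require Import all_boot all_order all_algebra.
From mathcomp Require Import all_classical all_reals all_analysis.
From mathcomp Require Import ring lra.
Import Order.TTheory GRing.Theory Num.Theory.
Import numFieldNormedType.Exports.
Local Open Scope classical_set_scope.
Local Open Scope ring_scope.

Set Implicit Arguments.
Unset Strict Implicit.
Unset Printing Implicit Defensive.

(** * Differentiability of C^k functions *)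

(** Write [a] for [1 - p p^T / v^2] and [S = h + 2 M]. In [ln (1 + p . Du)] the equation yields the
    square [|D ln (1 + p . Du)|_a^2] twice with a good sign, and the logarithm gives it back once.
    By the first derivative test the surplus is [|2 y / eta + (S / t) p|_a^2]. Its part in
    [1 / eta^2] cancels the bad term of [ln eta]. Its part [(S / t)^2 (1 - 1 / v^2)] beats
    [S^2 / (2 t^2)], the time derivative of the exponent, once [v >= 2]. The factor [t] of [phi],
    hence [q = 2], contributes [- 1 / t] and absorbs [|p|_a^2 / t]. The shift by [2 M] makes
    [S >= M], so [phi >= M^4 / (16 t)], and a maximum above 1 forces [v] to be large for small [t].

    Smoothness is given by directional derivatives of local extensions, so differentiability and the
    symmetry of second derivatives have to be derived. The hyperplane carries no coordinates;
    computing with functions constant along [w] allows ambient ones. *)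

Lemma is_derive_line (R : numFieldType) (V W : normedModType R) (f : V -> W)
    (x v : V) (s : R) :
  derivable f (x + s *: v) v ->
  is_derive s 1 (fun t : R => f (x + t *: v)) ('D_v f (x + s *: v)).
Proof.
move=> df.
have e : (fun h : R => h^-1 *: (((fun t : R => f (x + t *: v)) \o shift s) (h *: 1) -
    f (x + s *: v))) =
  (fun h : R => h^-1 *: ((f \o shift (x + s *: v)) (h *: v) - f (x + s *: v))).
  rewrite funeqE => h /=; congr (_ *: (f _ - _)).
  by rewrite [h *: 1]mulr1 scalerDl addrCA.
by split; rewrite /derivable /derive e.
Qed.

(** A mean value theorem based at [0] for either sign of [c]; the bounds are not strict so that
    [c = 0] is covered. *)
Lemma MVT0 (R : realType) (f df : R -> R) (c : R) :
  (forall s : R, `|s| <= `|c| -> is_derive s 1 f (df s)) ->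
  exists2 s, `|s| <= `|c| & f c - f 0 = df s * c.
Proof.
move=> fdf.
have cf (a b : R) : `|a| <= `|c| -> `|b| <= `|c| -> {within `[a, b], continuous f}.
  move=> ac bc; apply: derivable_within_continuous => s; rewrite in_itv /= => /andP[as_ sb].
  have /fdf h : `|s| <= `|c|.
    move: ac bc; rewrite !ler_norml => /andP[ac _] /andP[_ bc].
    by rewrite (le_trans ac as_) (le_trans sb bc).
  exact: ex_derive.
have [c0|c0|c0] := ltgtP 0 c.
- have [||s] := @MVT R f df 0 c c0.
  + move=> s; rewrite in_itv /= => /andP[s0 sc]; apply: fdf.
    by rewrite !gtr0_norm// ltW.
  + by apply: cf; rewrite ?normr0.
  rewrite in_itv /= => /andP[s0 sc] e; exists s; first by rewrite !gtr0_norm// ltW.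
  by rewrite e subr0.
- have [||s] := @MVT R f df c 0 c0.
  + move=> s; rewrite in_itv /= => /andP[s0 sc]; apply: fdf.
    by rewrite !ltr0_norm// lerN2 ltW.
  + by apply: cf; rewrite ?normr0.
  rewrite in_itv /= => /andP[s0 sc] e; exists s; first by rewrite !ltr0_norm// lerN2 ltW.
  by rewrite -opprB e sub0r mulrN opprK.
- by exists 0; rewrite -?c0 ?normr0 ?mulr0 ?subrr.
Qed.

Section Frechet.
Context {R : realType} {V : normedModType R}.
Implicit Types (f : V -> R) (A : set V).

(* Uniformity in the base point [y] is what allows increments along several
   directions to be added up. *)
Definition strict_derive f (x v : V) := forall e : R, 0 < e ->
  exists2 d : R, 0 < d & forall (y : V) (c : R), `|y - x| < d -> `|c| < d ->
    `|f (y + c *: v) - f y - c * 'D_v f x| <= e * `|c|.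

(** The mean value theorem on the segment from [y] to [y + c *: v], where by continuity the
    derivative is close to its value at [x]. *)
Lemma C1_strict_derive f A x v : open A -> A x ->
  (forall y, A y -> derivable f y v) -> {for x, continuous (fun y => 'D_v f y)} ->
  strict_derive f x v.
Proof.
move=> oA Ax dA /cvgrPdist_le cD e e0.
have /nbhs_normP[r /= r0 rA] : nbhs x (A `&` [set y | `|'D_v f x - 'D_v f y| <= e]).
  by apply: filterI; [exact: open_nbhs_nbhs|exact: cD].
(* With this radius the whole segment stays within [r] of [x]. *)
pose d := r / (2 * (1 + `|v|)).
have v1 : 0 < 1 + `|v| by rewrite ltr_wpDr.
have d0 : 0 < d by rewrite divr_gt0// mulr_gt0.
have hr : d * (1 + `|v|) * 2 = r by rewrite /d; field; rewrite gt_eqF.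
exists d => // y c yx cd.
have inr s : `|s| <= `|c| -> ball_ Num.Def.normr x r (y + s *: v).
  move=> sc; rewrite /ball_ /= opprD addrA (le_lt_trans (ler_normB _ _))//.
  rewrite distrC normrZ -hr.
  have : `|s| * `|v| <= d * `|v| by rewrite ler_wpM2r// (le_trans sc)// ltW.
  nra.
have [s sc] := @MVT0 R (fun s => f (y + s *: v)) (fun s => 'D_v f (y + s *: v)) c
  (fun s sc => is_derive_line (dA _ (rA _ (inr s sc)).1)).
rewrite scale0r addr0 => ->.
rewrite mulrC -mulrBr normrM mulrC ler_wpM2r// distrC.
exact: (rA _ (inr s sc)).2.
Qed.

Lemma strict_derive_sum (I : Type) f x (v : I -> V) (s : seq I) :
  (forall i, strict_derive f x (v i)) ->
  forall e : R, 0 < e ->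
  exists2 d : R, 0 < d & forall (y : V) (c : I -> R), `|y - x| < d ->
    (forall i, `|c i| < d) ->
    `|f (y + \sum_(i <- s) c i *: v i) - f y - \sum_(i <- s) c i * 'D_(v i) f x|
       <= e * \sum_(i <- s) `|c i|.
Proof.
move=> sd e e0; elim: s => [|i s [d d0 IH]].
  by exists 1 => // y c _ _; rewrite !big_nil addr0 subrr subr0 normr0 mulr0.
have [d' d'0 H] := sd i e e0.
have v1 : 0 < 1 + `|v i| by rewrite ltr_wpDr.
(* The tail is based at the shifted point [y + c i *: v i], which this radius keeps within [d] of
   [x]. *)
pose d2 := Num.min d' (d / (2 * (1 + `|v i|))).
have hr : d / (2 * (1 + `|v i|)) * (1 + `|v i|) * 2 = d by field; rewrite gt_eqF.
have d20 : 0 < d / (2 * (1 + `|v i|)) by rewrite divr_gt0// mulr_gt0.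
exists d2 => [|y c yx cd]; first by rewrite /d2 lt_min d'0 d20.
move: yx; rewrite /d2 lt_min => /andP[yx yx2].
have cdi j : `|c j| < d' /\ `|c j| < d / (2 * (1 + `|v i|)).
  by apply/andP; rewrite -lt_min.
rewrite !big_cons addrA.
have dd : d / (2 * (1 + `|v i|)) <= d.
  rewrite -[leRHS]hr -mulrA ler_peMr//; last by have := normr_ge0 (v i); lra.
  exact: ltW.
have {}IH := IH (y + c i *: v i) c _ _; have {}H := H y (c i) yx (cdi i).1.
rewrite mulrDr.
have tri (z1 z2 z3 z4 z5 : R) : `|z1 - z2 - (z3 + z4)| <= `|z5 - z2 - z3| + `|z1 - z5 - z4|.
  have -> : z1 - z2 - (z3 + z4) = (z5 - z2 - z3) + (z1 - z5 - z4) by ring.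
  exact: ler_normD.
apply: (le_trans (tri _ _ _ _ (f (y + c i *: v i)))); apply: lerD; first exact: H.
apply: IH => [|j]; last by rewrite (lt_le_trans (cdi j).2).
rewrite addrAC (le_lt_trans (ler_normD _ _))// normrZ.
have : `|c i| * `|v i| <= d / (2 * (1 + `|v i|)) * `|v i|.
  by rewrite ler_wpM2r// ltW// (cdi i).2.
by move: hr yx2; set q := d / _ => hr yx2; nra.
Qed.

(** The increments along the coordinate directions add up to the candidate differential [L]. The
    coordinate system is abstract because the intended space is a product of row vectors with a time
    line. *)
Lemma strict_differentiable (I : finType) f x (v : I -> V) (c : I -> {linear V -> R}) :
  (forall h : V, h = \sum_i c i h *: v i) -> (forall i h, `|c i h| <= `|h|) ->
  (forall i, strict_derive f x (v i)) -> differentiable f x.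
Proof.
move=> hc cle sd.
pose L := (fun h : V => \sum_i c i h * 'D_(v i) f x).
have linL : linear (L : V -> R).
  move=> a y z; rewrite /L scaler_sumr -big_split /=; apply: eq_bigr => i _.
  by rewrite linearP mulrDl -scalerAl.
pose LM := GRing.isLinear.Build _ _ _ _ _ linL.
pose Ll : {linear V -> R} := HB.pack L LM.
have cL : continuous Ll.
  have : bounded_near Ll (nbhs 0).
    apply/ex_bound => /=.
    exists (\sum_i `|'D_(v i) f x|).
    near=> h; apply: (le_trans (ler_norm_sum _ _ _)); apply: ler_sum => i _.
    rewrite normrM ler_piMl// (le_trans (cle i h))//.
  by move/linear_bounded_continuous.
have key : f \o shift x = cst (f x) + Ll +o_ 0 id.
  apply/eqaddoP => e e0.
  (* The absolute values of the coordinates of [h] sum to at most [#|I|] times its norm; the added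
     [1] keeps the divisor positive. *)
  have [d d0 H] := strict_derive_sum (index_enum I) sd (e := e / (1 + #|I|%:R))
    ltac:(by rewrite divr_gt0// ltr_wpDr).
  near=> h.
  have hd : `|h| < d by near: h; exact: (@nbhs0_lt _ V d d0).
  have := H x (fun i => c i h); rewrite -hc subrr normr0 => /(_ d0).
  have hh : forall i, `|c i h| < d by move=> i; rewrite (le_lt_trans (cle i h)).
  move=> /(_ hh) {}H.
  have -> : (f \o shift x - (cst (f x) + Ll)) h = f (x + h) - f x - L h.
    change (f (h + x) - (f x + L h) = f (x + h) - f x - L h).
    by rewrite opprD addrA [x + h]addrC.
  apply: (le_trans H) => /=.
  have : \sum_i `|c i h| <= #|I|%:R * `|h|.
    rewrite mulr_natl -sumr_const; apply: ler_sum => i _; exact: cle.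
  have e1 : e / (1 + #|I|%:R) * (1 + #|I|%:R) = e by field; rewrite gt_eqF// ltr_wpDr.
  move=> H1; have -> : e * `|h| = e / (1 + #|I|%:R) * ((1 + #|I|%:R) * `|h|).
    by rewrite mulrA e1.
  apply: ler_wpM2l; first by rewrite divr_ge0 ?ltW// ltr_wpDr.
  by rewrite (le_trans H1)// mulrDl mul1r lerDr.
have dE := diff_unique cL key.
by apply/diff_locallyP; rewrite dE.
Unshelve. all: by end_near. Qed.

End Frechet.

(** * Affine substitution, locality and symmetry of second derivatives *)

Section CkTheory.
Context {R : realType}.

Lemma CkS_derivable (V W : normedModType R) (A : set V) (f : V -> W) v x :
  (forall k, Ck k A f) -> A x -> derivable f x v.
Proof. by move=> /(_ 1%N)[_ /(_ v)[h _]] Ax; exact: h. Qed.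

Lemma Ck_continuous (V W : normedModType R) (A : set V) (f : V -> W) x :
  (forall k, Ck k A f) -> A x -> {for x, continuous f}.
Proof. by move=> /(_ 0%N)[h _] Ax; exact: h. Qed.

Lemma Ck_derive (V W : normedModType R) (A : set V) (f : V -> W) v :
  (forall k, Ck k A f) -> forall k, Ck k A ('D_v f).
Proof. by move=> fk k; have [_ /(_ v)[_ h]] := fk k.+1. Qed.

Lemma Ck_subset (V W : normedModType R) (A B : set V) (f : V -> W) k :
  B `<=` A -> Ck k A f -> Ck k B f.
Proof.
move=> BA; elim: k f => [|k IH] f /= [fc fd]; first by split=> // x /BA/fc.
split=> [x /BA/fc//|v].
by have [fv fk] := fd v; split=> [x /BA/fv//|]; exact: IH.
Qed.

Lemma derive_affine (U V W : normedModType R) (L : {linear U -> V}) (c : V)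
    (f : V -> W) x v :
  'D_v (fun x => f (L x + c)) x = 'D_(L v) f (L x + c).
Proof.
rewrite /derive; set g1 := (X in X @ _); set g2 := (X in _ = lim (X @ _)).
suff -> : g1 = g2 by [].
by apply/funext => h; rewrite /g1 /g2 /= linearP addrA.
Qed.

Lemma derivable_affine (U V W : normedModType R) (L : {linear U -> V}) (c : V)
    (f : V -> W) x v :
  derivable f (L x + c) (L v) -> derivable (fun x => f (L x + c)) x v.
Proof.
rewrite /derivable; set g1 := (X in X @ _); set g2 := (X in _ -> cvg (X @ _)).
suff -> : g2 = g1 by [].
by apply/funext => h; rewrite /g1 /g2 /= linearP addrA.
Qed.

(** Directional derivatives pass through an affine substitution with [v] replaced by [L v], so
    induction on [k] needs no chain rule. It serves both to freeze the time and to pull back along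
    the projection to the hyperplane. *)
Lemma Ck_comp_affine (U V W : normedModType R) (L : {linear U -> V}) (c : V)
    (A : set V) (f : V -> W) k : continuous L ->
  Ck k A f -> Ck k [set x | A (L x + c)] (fun x => f (L x + c)).
Proof.
move=> cL; have cfL (A' : set V) (g : V -> W) : (forall x, A' x -> {for x, continuous g}) ->
    forall x, [set x | A' (L x + c)] x -> {for x, continuous (fun x => g (L x + c))}.
  move=> gc x Ax; apply: (@continuous_comp _ _ _ (fun x => L x + c) g); last exact: gc.
  by apply: cvgD; [exact: cL|exact: cvg_cst].
elim: k f => [|k IH] f /= [fc fd]; first by split=> //; exact: cfL.
split; first exact: cfL.
move=> v; have [fv fk] := fd (L v); split=> [x Ax|].
  by apply: derivable_affine; exact: fv.
have -> : 'D_v (fun x => f (L x + c)) = fun x => 'D_(L v) f (L x + c).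
  by apply/funext => x; exact: derive_affine.
exact: (IH ('D_(L v) f)).
Qed.

(** Derivatives at points of an open set see only the values on it. This transfers smoothness from
    the local extensions in [smooth_on] to the map itself. *)
Lemma Ck_local_eq (V W : normedModType R) (A : set V) (f g : V -> W) k :
  open A -> (forall x, A x -> f x = g x) -> Ck k A f -> Ck k A g.
Proof.
move=> oA.
have fgn (f' g' : V -> W) x : (forall x, A x -> f' x = g' x) -> A x -> \near x, f' x = g' x.
  by move=> fg' Ax; near=> y; rewrite fg'//; near: y; exact: open_nbhs_nbhs.
have cfg (f' g' : V -> W) x : (forall x, A x -> f' x = g' x) -> A x ->
    {for x, continuous f'} -> {for x, continuous g'}.
  move=> fg' Ax fc; suff : g' @ x --> g' x by [].
  have : f' @ x --> f' x by exact: fc.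
  rewrite (fg' x Ax); apply: cvg_trans.
  by apply: near_eq_cvg; have := fgn _ _ _ fg' Ax; apply: filterS => y ->.
elim: k f g => [|k IH] f g fg /= [fc fd].
  by split=> // x Ax; exact: (cfg _ _ _ fg Ax (fc _ Ax)).
split=> [x Ax|v]; first exact: (cfg _ _ _ fg Ax (fc _ Ax)).
have [fv fk] := fd v; split=> [x Ax|]; first exact: (near_eq_derivable (fgn _ _ _ fg Ax) (fv x Ax)).
by apply: IH fk => x Ax; apply: near_eq_derive; exact: fgn fg Ax.
Unshelve. all: by end_near. Qed.

(** Two mean value theorems, first in [u] for the difference in direction [v], then in [v] for
    ['D_u f], turn the second difference into [s ^+ 2] times the mixed derivative at a point near
    [x]. *)
Lemma second_difference (V : normedModType R) (A : set V) (f : V -> R) x u v :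
  open A -> (forall k, Ck k A f) -> A x -> forall e : R, 0 < e ->
  exists2 d : R, 0 < d & forall s : R, 0 < s -> s < d ->
    `|f (x + s *: v + s *: u) - f (x + s *: u) - (f (x + s *: v) - f x) -
      'D_v ('D_u f) x * s ^+ 2| <= e * s ^+ 2.
Proof.
move=> oA fk Ax e e0.
have := Ck_continuous (Ck_derive v (Ck_derive u fk)) Ax.
move=> /cvgrPdist_le/(_ e e0) cD.
have /nbhs_normP[r /= r0 rA] :
    nbhs x (A `&` [set y | `|'D_v ('D_u f) x - 'D_v ('D_u f) y| <= e]).
  by apply: filterI; [exact: open_nbhs_nbhs|exact: cD].
have uv : 0 < 1 + `|u| + `|v| by rewrite !ltr_wpDr.
exists (r / (1 + `|u| + `|v|)); first by rewrite divr_gt0.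
move=> s s0; rewrite ltr_pdivlMr// => sr.
have inr (a b : R) : `|a| <= `|s| -> `|b| <= `|s| ->
    ball_ Num.Def.normr x r (x + a *: v + b *: u).
  rewrite (gtr0_norm s0) => la lb; rewrite /ball_ /= -addrA opprD addrA subrr sub0r normrN.
  rewrite (le_lt_trans (ler_normD _ _))// !normrZ.
  have : `|a| * `|v| <= s * `|v| by rewrite ler_wpM2r.
  have : `|b| * `|u| <= s * `|u| by rewrite ler_wpM2r.
  nra.
have le0 : `|0 : R| <= `|s| by rewrite normr0.
have H0 (b : R) : `|b| <= `|s| ->
    is_derive b 1 (fun b => f (x + s *: v + b *: u) - f (x + b *: u))
      ('D_u f (x + s *: v + b *: u) - 'D_u f (x + b *: u)).
  move=> bs; apply: is_deriveB; apply: is_derive_line; apply: (CkS_derivable fk).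
    exact: (rA _ (inr s b (lexx _) bs)).1.
  by have := (rA _ (inr 0 b le0 bs)).1; rewrite scale0r addr0.
have [b bs] := @MVT0 R _ _ s H0.
rewrite !scale0r !addr0 => ->.
have H (a : R) : `|a| <= `|s| -> is_derive a 1 (fun a : R => 'D_u f (x + b *: u + a *: v))
    ('D_v ('D_u f) (x + b *: u + a *: v)).
  move=> as_; apply: is_derive_line; apply: (CkS_derivable (Ck_derive u fk)).
  by rewrite addrAC; exact: (rA _ (inr a b as_ bs)).1.
have [a as_] := @MVT0 R _ _ s H.
rewrite scale0r addr0 addrAC => ->.
rewrite expr2 -mulrA -mulrBl normrM.
have ss : 0 <= s * s by rewrite mulr_ge0// ltW.
rewrite (ger0_norm ss); apply: ler_wpM2r => //.
by rewrite distrC addrAC; exact: (rA _ (inr a b as_ bs)).2.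
Qed.

Lemma cross_difference_le (a b q e z1 z2 z3 z4 : R) :
  `|z1 - z2 - (z3 - z4) - b * q| <= e / 2 * q ->
  `|z1 - z3 - (z2 - z4) - a * q| <= e / 2 * q -> `|(a - b) * q| <= e * q.
Proof.
by move=> /ler_normlP[? ?] /ler_normlP[? ?]; apply/ler_normlP; split; lra.
Qed.

(** The second difference is symmetric in [u] and [v] and approximates both mixed derivatives times
    [s ^+ 2]; dividing by [s ^+ 2] leaves an arbitrarily small error. *)
Lemma derive_comm (V : normedModType R) (A : set V) (f : V -> R) x u v :
  open A -> (forall k, Ck k A f) -> A x -> 'D_v ('D_u f) x = 'D_u ('D_v f) x.
Proof.
move=> oA fk Ax; apply/eqP; rewrite -subr_eq0 -normr_eq0 eq_le normr_ge0 andbT.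
apply/ler_addgt0Pl => e e0; rewrite addr0.
have e20 : 0 < e / 2 by rewrite divr_gt0.
have [d d0 Hd] := second_difference u v oA fk Ax e20.
have [d' d'0 Hd'] := second_difference v u oA fk Ax e20.
pose s := Num.min d d' / 2.
have m0 : 0 < Num.min d d' by rewrite lt_min d0 d'0.
have s0 : 0 < s by rewrite divr_gt0.
have : s < Num.min d d' by rewrite /s; move: m0; set m := Num.min _ _ => m0; lra.
rewrite lt_min => /andP[sd sd'].
have s20 : 0 < s ^+ 2 by rewrite exprn_gt0.
have := Hd s s0 sd; have := Hd' s s0 sd'.
rewrite (addrAC x) => H1 H2.
rewrite -(ler_pM2r s20) -[X in _ * X <= _](gtr0_norm s20) -normrM.
exact: cross_difference_le H1 H2.
Qed.

End CkTheory.

(** * Linear algebra *)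

Section DotProduct.
Context {R : realType} {m : nat}.
Implicit Types x y z : 'rV[R]_m.

Lemma dotvE x y : dotv x y = (x *m y^T) 0 0.
Proof. by rewrite mxE; apply: eq_bigr => i _; rewrite mxE. Qed.

Lemma dotvC x y : dotv x y = dotv y x.
Proof. by apply: eq_bigr => i _; rewrite mulrC. Qed.

Lemma dotvDl x y z : dotv (x + y) z = dotv x z + dotv y z.
Proof. by rewrite !dotvE mulmxDl mxE. Qed.

Lemma dotvZl a x y : dotv (a *: x) y = a * dotv x y.
Proof. by rewrite !dotvE -scalemxAl mxE. Qed.

Lemma dotvBl x y z : dotv (x - y) z = dotv x z - dotv y z.
Proof. by rewrite -scaleN1r dotvDl dotvZl mulN1r. Qed.

Lemma dotvDr x y z : dotv x (y + z) = dotv x y + dotv x z.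
Proof. by rewrite !(dotvC x) dotvDl. Qed.

Lemma dotvZr a x y : dotv x (a *: y) = a * dotv x y.
Proof. by rewrite !(dotvC x) dotvZl. Qed.

Lemma dotvBr x y z : dotv x (y - z) = dotv x y - dotv x z.
Proof. by rewrite !(dotvC x) dotvBl. Qed.

Lemma dotv_sumr (I : Type) (s : seq I) (F : I -> 'rV[R]_m) x :
  dotv x (\sum_(i <- s) F i) = \sum_(i <- s) dotv x (F i).
Proof.
elim/big_rec2 : _ => [|i a b _ <-]; last exact: dotvDr.
by rewrite -[0](scale0r 0) dotvZr mul0r.
Qed.

Lemma dotv_ge0 x : 0 <= dotv x x.
Proof. by apply: sumr_ge0 => i _; rewrite -expr2 sqr_ge0. Qed.

Lemma dotv_eq0 x : (dotv x x == 0) = (x == 0).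
Proof.
apply/idP/eqP => [|->]; last by rewrite /dotv big1// => i _; rewrite mxE mul0r.
rewrite psumr_eq0; last by move=> i _; rewrite -expr2 sqr_ge0.
move=> /allP h; apply/rowP => i; rewrite mxE.
by have := h i (mem_index_enum _); rewrite mulf_eq0 orbb => /eqP.
Qed.

Lemma dotv_CS x y : dotv x y ^+ 2 <= dotv x x * dotv y y.
Proof.
have [y0|y0] := eqVneq (dotv y y) 0.
  have -> : y = 0 by apply/eqP; rewrite -dotv_eq0 y0.
  rewrite -[X in dotv x X](scale0r 0) dotvZr mul0r expr0n/=.
  by rewrite mulr_ge0 ?dotv_ge0.
have y1 : 0 < dotv y y by rewrite lt_neqAle eq_sym y0 dotv_ge0.
have := dotv_ge0 (dotv y y *: x - dotv x y *: y).
rewrite dotvBl !dotvBr !dotvZl !dotvZr (dotvC y x).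
have -> : dotv y y * (dotv y y * dotv x x) - dotv y y * (dotv x y * dotv x y) -
  (dotv x y * (dotv y y * dotv x y) - dotv x y * (dotv x y * dotv y y)) =
  dotv y y * (dotv x x * dotv y y - dotv x y ^+ 2) by ring.
by rewrite pmulr_rge0// subr_ge0.
Qed.

Lemma dotv_delta x k : dotv x (delta_mx 0 k) = x 0 k.
Proof.
rewrite /dotv (bigD1 k)//= big1 => [|i ik]; last first.
  by rewrite mxE (negbTE ik) andbF mulr0.
by rewrite mxE !eqxx mulr1 addr0.
Qed.

End DotProduct.

(** * Traces of bilinear forms given as functions of two directions *)

Section BilinearForm.
Context {R : realType} {m : nat}.
Variable B : 'rV[R]_m -> 'rV[R]_m -> R.
Hypothesis Bl : forall a u u' v, B (a *: u + u') v = a * B u v + B u' v.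
Hypothesis Br : forall a u v v', B u (a *: v + v') = a * B u v + B u v'.

Local Notation e k := (delta_mx 0 k : 'rV[R]_m).

Lemma form0l v : B 0 v = 0.
Proof. by have := Bl (-1) 0 0 v; rewrite scaler0 addr0 mulN1r addNr. Qed.

Lemma form0r u : B u 0 = 0.
Proof. by have := Br (-1) u 0 0; rewrite scaler0 addr0 mulN1r addNr. Qed.

Lemma form_suml (I : Type) (s : seq I) (a : I -> R) (u : I -> 'rV[R]_m) v :
  B (\sum_(i <- s) a i *: u i) v = \sum_(i <- s) a i * B (u i) v.
Proof.
by elim: s => [|i s IH]; rewrite ?big_nil ?form0l// !big_cons Bl IH.
Qed.

Lemma form_sumr (I : Type) (s : seq I) (a : I -> R) (v : I -> 'rV[R]_m) u :
  B u (\sum_(i <- s) a i *: v i) = \sum_(i <- s) a i * B u (v i).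
Proof.
by elim: s => [|i s IH]; rewrite ?big_nil ?form0r// !big_cons Br IH.
Qed.

Lemma form_expand u v : B u v = \sum_k \sum_l u 0 k * v 0 l * B (e k) (e l).
Proof.
rewrite {1}(row_sum_delta u) {1}(row_sum_delta v) form_suml; apply: eq_bigr => k _.
by rewrite form_sumr mulr_sumr; apply: eq_bigr => l _; rewrite mulrA.
Qed.

(* For [V2 = 1 + |p|^2] the vectors [e_k - th p_k p] are the rows of the square
   root of [1 - p p^T / V2]. *)
Lemma form_tr_sqrt (p : 'rV[R]_m) (th V2 : R) :
  2 * th - th ^+ 2 * dotv p p = V2^-1 ->
  \sum_k B (e k - (th * p 0 k) *: p) (e k - (th * p 0 k) *: p) =
  \sum_k B (e k) (e k) - B p p / V2.
Proof.
move=> <-.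
have E k : B (e k - (th * p 0 k) *: p) (e k - (th * p 0 k) *: p) =
    B (e k) (e k) - th * (p 0 k * B (e k) p) - th * (p 0 k * B p (e k)) +
    (p 0 k * p 0 k) * (th ^+ 2 * B p p).
  by rewrite -[- (_ *: p)]scaleNr ![e k + _]addrC !Bl !Br; ring.
rewrite (eq_bigr _ (fun k _ => E k)) !big_split /= -mulr_suml -/(dotv p p).
rewrite !sumrN -!mulr_sumr -form_suml -row_sum_delta.
have -> : \sum_i p 0 i * B p (e i) = B p p.
  by rewrite -form_sumr -row_sum_delta.
by ring.
Qed.

(** Passing from the rows of [T] to the standard basis turns the weights [g] into [T^T *m g *m T];
    for the inverse metric this is the orthogonal projection onto the tangent space. *)
Lemma form_mx (n : nat) (T : 'M[R]_(n, m)) (g : 'M[R]_n) :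
  \sum_i \sum_j g i j * B (row i T) (row j T) =
  \sum_k \sum_l (T^T *m g *m T) k l * B (e k) (e l).
Proof.
under eq_bigr => i _ do under eq_bigr => j _ do
  rewrite form_expand mulr_sumr; under eq_bigr => i _ do rewrite exchange_big.
rewrite exchange_big /=; apply: eq_bigr => k _.
under eq_bigr => i _ do under eq_bigr => j _ do rewrite mulr_sumr.
under eq_bigr => i _ do rewrite exchange_big.
rewrite exchange_big /=; apply: eq_bigr => l _.
rewrite mxE exchange_big mulr_suml; apply: eq_bigr => j _ /=.
rewrite [(T^T *m g) k j]mxE !mulr_suml; apply: eq_bigr => i _.
by rewrite !mxE; ring.
Qed.

End BilinearForm.

(** * The tangent space of a hypersurface and its normal line *)

Section TangentProjection.
Context {R : realType} {n : nat}.
Variables (T : 'M[R]_(n, n.+1)) (N : 'rV[R]_n.+1).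
Hypotheses (T_free : row_free T) (TN : T *m N^T = 0) (N_neq0 : N != 0).

Lemma gram_unit : T *m T^T \in unitmx.
Proof.
rewrite -row_free_unit -kermx_eq0; apply/rowV0P => v /sub_kermxP vk.
have : dotv (v *m T) (v *m T) = 0.
  by rewrite dotvE trmx_mul mulmxA -(mulmxA v) vk mul0mx mxE.
move/eqP; rewrite dotv_eq0 => /eqP vT.
by apply: (row_free_inj T_free); rewrite mul0mx.
Qed.

(** If [a *m N + b *m T = 0], pairing with [N] kills [a], and the freeness of [T] then kills [b]. *)
Lemma normal_tangent_unit : (col_mx N T : 'M[R]_(n.+1)) \in unitmx.
Proof.
rewrite -row_free_unit -kermx_eq0; apply/rowV0P => v /sub_kermxP.
rewrite -[v](@hsubmxK _ 1 1 n).
move: (@lsubmx _ 1 1 n v) (@rsubmx _ 1 1 n v) => a b.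
rewrite (@mul_row_col _ 1 1 n n.+1) => h.
have NN : N *m N^T = (dotv N N)%:M by apply/rowP => i; rewrite ord1 -dotvE !mxE mulr1n.
have l0 : a = 0.
  have /(congr1 (fun A => A *m N^T)) := h.
  rewrite mulmxDl -!mulmxA TN mulmx0 addr0 NN mul0mx mul_mx_scalar => /eqP.
  by rewrite scaler_eq0 dotv_eq0 (negbTE N_neq0) /= => /eqP.
have r0 : b = 0.
  by move: h; rewrite l0 mul0mx add0r => h; apply: (row_free_inj T_free); rewrite mul0mx.
by rewrite l0 r0 row_mx0.
Qed.

(** Both sides annihilate [N] and fix the rows of [T], which together form a basis. [N] is not
    normalised, so no square root enters. *)
Lemma tangent_projE :
  T^T *m invmx (T *m T^T) *m T = 1%:M - (dotv N N)^-1 *: (N^T *m N).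
Proof.
apply/eqP; rewrite eq_sym subr_eq eq_sym; apply/eqP.
have NN : N *m N^T = (dotv N N)%:M by apply/rowP => i; rewrite ord1 -dotvE !mxE mulr1n.
have NT : N *m T^T = 0 by rewrite -[LHS]trmxK trmx_mul trmxK TN trmx0.
apply: (can_inj (mulKmx normal_tangent_unit)).
rewrite mulmx1 (@mul_col_mx _ 1 n n.+1).
rewrite !mulmxDr -!scalemxAr !mulmxA NN TN NT !mul0mx.
rewrite (mulmxV gram_unit) mul1mx mul_scalar_mx scalerA.
by rewrite mulVf ?dotv_eq0// scale1r scaler0 add0r addr0.
Qed.

Lemma tr_tangent (B : 'rV[R]_n.+1 -> 'rV[R]_n.+1 -> R) :
  (forall a u u' v, B (a *: u + u') v = a * B u v + B u' v) ->
  (forall a u v v', B u (a *: v + v') = a * B u v + B u v') ->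
  \sum_i \sum_j invmx (T *m T^T) i j * B (row i T) (row j T) =
  \sum_k B (delta_mx 0 k) (delta_mx 0 k) - B N N / dotv N N.
Proof.
move=> Bl Br; rewrite form_mx// tangent_projE (form_expand Bl Br N N) mulr_suml -sumrB.
apply: eq_bigr => k _.
transitivity (\sum_l ((k == l)%:R * B (delta_mx 0 k) (delta_mx 0 l) -
  N 0 k * N 0 l * B (delta_mx 0 k) (delta_mx 0 l) / dotv N N)).
  by apply: eq_bigr => l _; rewrite !mxE big_ord1 !mxE; ring.
rewrite sumrB mulr_suml (bigD1 k)//= eqxx mul1r big1 ?addr0// => l lk.
by rewrite eq_sym (negbTE lk) mul0r.
Qed.

(** The projection of [tangent_projE] kills [nu], so [nu] is a multiple of [N]; pairing with [nu]
    gives the size of the multiple. *)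
Lemma unit_normalE (nu : 'rV[R]_n.+1) : T *m nu^T = 0 -> dotv nu nu = 1 ->
  dotv N N *: nu = dotv nu N *: N /\ dotv nu N ^+ 2 = dotv N N.
Proof.
move=> Tnu nunu.
have nT : nu *m T^T = 0 by rewrite -[LHS]trmxK trmx_mul trmxK Tnu trmx0.
have /(congr1 (fun A => nu *m A)) := tangent_projE.
rewrite !mulmxA nT !mul0mx mulmxBr mulmx1 -scalemxAr mulmxA => /eqP.
have nuN : nu *m N^T = (dotv nu N)%:M by apply/rowP => i; rewrite ord1 -dotvE !mxE mulr1n.
have N0 : dotv N N != 0 by rewrite dotv_eq0.
rewrite eq_sym subr_eq0 nuN mul_scalar_mx scalerA => /eqP nuE.
have e : dotv N N *: nu = dotv nu N *: N by rewrite [X in _ *: X = _]nuE scalerA mulrA divff// mul1r.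
split=> //; have /(congr1 (dotv^~ nu)) := e.
by rewrite !dotvZl nunu mulr1 [dotv N nu]dotvC expr2.
Qed.

End TangentProjection.

(** * Functions of space and time *)

Section SpaceTime.
Context {R : realType} {m : nat}.
Local Notation ST := ('rV[R]_m * R)%type.
Implicit Types (A : set ST) (f : ST -> R) (z : ST) (u v : 'rV[R]_m).

Definition dx v f : ST -> R := 'D_((v, 0) : ST) f.
Definition dt f : ST -> R := 'D_((0, 1) : ST) f.
Definition grad f z : 'rV[R]_m := \row_k dx (delta_mx 0 k) f z.

(** The product norm and the sup norm on rows bound every coordinate, as [strict_differentiable]
    demands. *)
Lemma spacetime_differentiable A f z :
  open A -> (forall k, Ck k A f) -> A z -> differentiable f z.
Proof.
move=> oA fk Az.
pose c (i : 'I_m + unit) : ST -> R := fun h =>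
  match i with inl i => h.1 0 i | inr _ => h.2 end.
have linc i : linear (c i : ST -> R).
  by case: i => [i|i] a x y //=; rewrite !mxE.
pose cl i : {linear ST -> R} := HB.pack (c i) (GRing.isLinear.Build _ _ _ _ _ (linc i)).
pose v (i : 'I_m + unit) : ST := match i with inl i => (delta_mx 0 i, 0) | inr _ => (0, 1) end.
apply: (@strict_differentiable R ST _ f z v cl).
- move=> h; rewrite big_sumType /= (big_pred1 tt) => [|[]//].
  have -> : \sum_i c (inl i) h *: v (inl i) = (h.1, 0).
    rewrite [in RHS](row_sum_delta h.1).
    rewrite -[LHS]/(\sum_i (h.1 0 i *: ((delta_mx 0 i, 0) : ST))).
    elim/big_rec2 : _ => // i b a _ ->.
    by congr pair; rewrite /= ?scaler0 ?addr0.
  case: h => h1 h2 /=; rewrite /v/=; congr pair => /=.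
    by rewrite scaler0 addr0.
  by rewrite add0r [_ *: _]mulr1.
- move=> [i|i] [h1 h2] /=; rewrite prod_normE /= le_max; last by rewrite lexx orbT.
  by rewrite {2}/Num.Def.normr/= mx_normrE (le_bigmax _ (fun ij => `|h1 ij.1 ij.2|) (0, i)).
- move=> i; apply: (C1_strict_derive oA Az) => [y Ay|]; first exact: CkS_derivable Ay.
  exact: Ck_continuous (Ck_derive _ fk) Az.
Qed.

Lemma dt_def f z : dt f z = 'D_((0, 1) : ST) f z. Proof. by []. Qed.

Lemma dx_def v f z : dx v f z = 'D_((v, 0) : ST) f z. Proof. by []. Qed.

Section Smooth.
Variables (A : set ST) (f : ST -> R).
Hypotheses (oA : open A) (fk : forall k, Ck k A f).

Lemma Ck_dx v k : Ck k A (dx v f). Proof. exact: Ck_derive. Qed.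

Lemma Ck_dt k : Ck k A (dt f). Proof. exact: Ck_derive. Qed.

Lemma derive_spacetime z v s : A z -> 'D_((v, s) : ST) f z = dx v f z + s * dt f z.
Proof.
move=> Az; have df := spacetime_differentiable oA fk Az.
rewrite /dx /dt !deriveE// -[s * _]/(s *: _) -linearZ -linearD /=; congr ('d f z _).
by congr pair => /=; rewrite ?scaler0 ?addr0 ?add0r// [_ *: _]mulr1.
Qed.

Lemma dx_linear z a u v : A z -> dx (a *: u + v) f z = a * dx u f z + dx v f z.
Proof.
move=> Az; have df := spacetime_differentiable oA fk Az.
rewrite /dx !deriveE// -[a * _]/(a *: _) -linearP /=; congr ('d f z _).
by congr pair => /=; rewrite scaler0 addr0.
Qed.

Lemma dx_comm z u v : A z -> dx u (dx v f) z = dx v (dx u f) z.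
Proof. exact: derive_comm. Qed.

Lemma dx_dt_comm z u : A z -> dx u (dt f) z = dt (dx u f) z.
Proof. exact: derive_comm. Qed.

Lemma dx_grad z v : A z -> dx v f z = dotv v (grad f z).
Proof.
move=> Az; rewrite {1}(row_sum_delta v) /dotv.
elim/big_ind2 : _ => [|x x' y y' <- <-|i _].
- by have := @dx_linear z (-1) 0 0 Az; rewrite scaler0 addr0 mulN1r addNr.
- by have := @dx_linear z 1 x' y' Az; rewrite scale1r mul1r.
- have := @dx_linear z (v 0 i) (delta_mx 0 i) 0 Az; rewrite addr0 => ->.
  have := @dx_linear z (-1) 0 0 Az; rewrite scaler0 addr0 mulN1r addNr => ->.
  by rewrite addr0 mxE.
Qed.

End Smooth.

Lemma hess_linear A f z a u u' v : open A -> (forall k, Ck k A f) -> A z ->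
  dx (a *: u + u') (dx v f) z = a * dx u (dx v f) z + dx u' (dx v f) z.
Proof. by move=> oA fk Az; apply: (dx_linear oA (Ck_dx fk v)). Qed.

(** Linearity in the inner direction is reduced to the outer one by the symmetry of second
    derivatives. *)
Lemma hess_linearr A f z a u v v' : open A -> (forall k, Ck k A f) -> A z ->
  dx u (dx (a *: v + v') f) z = a * dx u (dx v f) z + dx u (dx v' f) z.
Proof.
move=> oA fk Az.
have c1 := dx_comm oA fk u (a *: v + v') Az.
have c2 := dx_comm oA fk u v Az; have c3 := dx_comm oA fk u v' Az.
apply: (etrans c1); apply: (etrans (hess_linear a v v' u oA fk Az)).
exact: (congr2 (fun x y => a * x + y) (esym c2) (esym c3)).
Qed.

End SpaceTime.

Lemma is_derive_snd (R : realType) (m : nat) (W : normedModType R)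
    (g : 'rV[R]_m * R -> W) x (s : R) :
  derivable g (x, s) (0, 1) ->
  is_derive s 1 (fun s : R => g (x, s)) ('D_((0, 1) : 'rV[R]_m * R) g (x, s)).
Proof.
have e (t : R) : (x, t) = ((x, 0) : 'rV[R]_m * R) + t *: ((0, 1) : 'rV[R]_m * R).
  by congr pair; rewrite /= ?scaler0 ?addr0// add0r [_ *: _]mulr1.
by move=> dg; under eq_fun do rewrite e; rewrite e; apply: is_derive_line; rewrite -e.
Qed.

Lemma is_derive_curve (R : realType) (V : normedModType R) (f : V -> R)
    (g : R -> V) (s : R) (dg : V) :
  is_derive s 1 g dg -> differentiable f (g s) ->
  is_derive s 1 (f \o g) ('D_dg f (g s)).
Proof.
move=> [/derivable1_diffP dgs <-] df.
have dfg : differentiable (f \o g) s by apply: differentiable_comp.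
split; first exact/derivable1_diffP.
by rewrite !deriveE// diff_comp.
Qed.

Section SpaceTimeLines.
Context {R : realType} {m : nat}.
Local Notation ST := ('rV[R]_m * R)%type.
Variables (A : set ST) (f : ST -> R).
Hypotheses (oA : open A) (fk : forall k, Ck k A f).

Lemma dx_local_eq (h : ST -> R) z v : A z -> (forall y, A y -> f y = h y) ->
  dx v f z = dx v h z.
Proof.
move=> Az fh; apply: near_eq_derive; near=> y; apply: fh.
by near: y; exact: open_nbhs_nbhs.
Unshelve. all: by end_near. Qed.

Lemma dx_local0 z v : A z -> (forall y, A y -> f y = 0) -> dx v f z = 0.
Proof.
by move=> Az f0; rewrite (dx_local_eq (h := cst 0) v Az)// /dx derive_cst.
Qed.

Lemma is_derive_dx x v t (s : R) : A (x + s *: v, t) ->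
  is_derive s 1 (fun s : R => f (x + s *: v, t)) (dx v f (x + s *: v, t)).
Proof.
move=> As.
have e (r : R) : (x + r *: v, t) = ((x, t) : ST) + r *: ((v, 0) : ST).
  by congr pair; rewrite /= scaler0 addr0.
under eq_fun do rewrite e.
by rewrite e; apply: is_derive_line; rewrite -e; exact: CkS_derivable As.
Qed.

Lemma is_derive_dt x (s : R) : A (x, s) ->
  is_derive s 1 (fun s : R => f (x, s)) (dt f (x, s)).
Proof. by move=> As; apply: is_derive_snd; exact: CkS_derivable As. Qed.

End SpaceTimeLines.

#[global] Opaque dx dt.

Lemma is_derive_line0 (R : numFieldType) (V W : normedModType R) (f : V -> W)
    (x v : V) (df : W) :
  is_derive (0 : R) 1 (fun h : R => f (h *: v + x)) df <-> is_derive x v f df.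
Proof.
have e : (fun h : R => h^-1 *: (((fun h : R => f (h *: v + x)) \o shift (0 : R)) (h *: 1) -
    f (0 *: v + x))) = (fun h : R => h^-1 *: ((f \o shift x) (h *: v) - f x)).
  by rewrite funeqE => h /=; rewrite addr0 scale0r add0r [_%:A]mulr1.
by split=> -[]; rewrite /derivable /derive ?e -?e => h1 h2; split; rewrite /derivable /derive ?e -?e.
Qed.

(** Restricted to the line in direction [v], [g] becomes a curve, so a directional derivative of [g]
    combines with the full differential of [f]. *)
Lemma is_derive_comp_diff (R : realType) (U V : normedModType R) (f : V -> R)
    (g : U -> V) (x v : U) (dg : V) :
  is_derive x v g dg -> differentiable f (g x) ->
  is_derive x v (f \o g) ('D_dg f (g x)).
Proof.
move=> /is_derive_line0 dgx df; apply/is_derive_line0.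
have := @is_derive_curve R V f _ 0 dg dgx; rewrite scale0r add0r; exact.
Qed.

Lemma cvg_dotv (R : realType) (m : nat) (T : Type) (F : set_system T) {FF : Filter F}
    (f g : T -> 'rV[R]_m) (a b : 'rV[R]_m) :
  f @ F --> a -> g @ F --> b -> dotv (f x) (g x) @[x --> F] --> dotv a b.
Proof.
move=> fa gb; apply: cvg_big => [|i _]; first exact: add_continuous.
apply: cvgM; first exact: (cvg_comp _ _ fa (@coord_continuous R 1 m 0 i a)).
exact: (cvg_comp _ _ gb (@coord_continuous R 1 m 0 i b)).
Qed.

Lemma continuous_dotv (R : realType) (m : nat) (w : 'rV[R]_m) :
  continuous (fun y : 'rV[R]_m => dotv y w).
Proof. by move=> y; exact: (cvg_dotv (@cvg_id _ (nbhs y)) (@cvg_cst _ w _ (nbhs y) _)). Qed.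

Lemma is_derive_dotv (R : realType) (m : nat) (U : normedModType R) (w : 'rV[R]_m)
    (g : U -> 'rV[R]_m) (x v : U) (dg : 'rV[R]_m) :
  is_derive x v g dg -> is_derive x v (fun y => dotv (g y) w) (dotv dg w).
Proof.
move=> [dgx <-].
have h : (fun h : R => h^-1 *: (((fun y => dotv (g y) w) \o shift x) (h *: v) - dotv (g x) w))
    @ 0^' --> dotv ('D_v g x) w.
  have -> : (fun h : R => h^-1 *: (((fun y => dotv (g y) w) \o shift x) (h *: v) - dotv (g x) w)) =
     (fun y => dotv y w) \o (fun h : R => h^-1 *: ((g \o shift x) (h *: v) - g x)).
    by apply/funext => h /=; rewrite dotvZl dotvBl.
  apply: continuous_cvg => //.
  exact: continuous_dotv.
split; last exact: cvg_lim h.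
by apply/cvg_ex; exists (dotv ('D_v g x) w).
Qed.

Lemma is_derive_pair_cst (R : realType) (m : nat) (U : normedModType R)
    (g : U -> 'rV[R]_m) (t : R) (x v : U) (dg : 'rV[R]_m) :
  is_derive x v g dg ->
  is_derive x v (fun y => (g y, t) : 'rV[R]_m * R) ((dg, 0) : 'rV[R]_m * R).
Proof.
move=> /is_derive_line0[/derivable1_diffP dg0 dgE]; apply/is_derive_line0.
have d2 : differentiable (fun h : R => (g (h *: v + x), t) : 'rV[R]_m * R) 0.
  by apply: differentiable_pair => //; exact: differentiable_cst.
split; first exact/derivable1_diffP.
rewrite deriveE// diff_pair//=.
by rewrite diff_cst -dgE deriveE.
Qed.

(** * The graph equation *)

Section GraphSlice.
Context {R : realType} {n : nat}.
Local Notation ST := ('rV[R]_n.+1 * R)%type.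
Variables (X : 'rV[R]_n -> 'rV[R]_n.+1) (B : set 'rV[R]_n).
Variables (f : ST -> R) (A : set ST) (w : 'rV[R]_n.+1) (t : R).
Hypotheses (oB : open B) (Xk : forall k, Ck k B X).
Hypotheses (oA : open A) (fk : forall k, Ck k A f).
Hypothesis XA : forall y, B y -> A (X y, t).
Hypothesis Xgraph : forall y, B y -> dotv (X y) w = f (X y, t).
Hypothesis w1 : dotv w w = 1.
Hypothesis fw : forall z, A z -> dx w f z = 0.

Lemma is_derive_slice (h : ST -> R) y (v : 'rV[R]_n) : B y ->
  (forall k, Ck k A h) ->
  is_derive y v (fun y => h (X y, t)) (dx ('D_v X y) h (X y, t)).
Proof.
move=> By hk; have dX : is_derive y v X ('D_v X y).
  by apply: derivableP; exact: CkS_derivable By.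
exact: (is_derive_comp_diff (is_derive_pair_cst t dX)
  (spacetime_differentiable oA hk (XA By))).
Qed.

(** Differentiating [Xgraph] shows that the tangent vectors are orthogonal to [w - grad f]. *)
Lemma slice_tangent y (v : 'rV[R]_n) : B y ->
  dotv ('D_v X y) w = dotv ('D_v X y) (grad f (X y, t)).
Proof.
move=> By; rewrite -(dx_grad oA fk _ (XA By)).
have dX : is_derive y v X ('D_v X y).
  by apply: derivableP; exact: CkS_derivable By.
have [_ <-] := is_derive_dotv w dX.
have [_ <-] := is_derive_slice v By fk.
apply: near_eq_derive; near=> z; apply: Xgraph.
by near: z; exact: open_nbhs_nbhs.
Unshelve. all: by end_near. Qed.

(** Differentiating [slice_tangent] once more: the terms with ['D_u ('D_v X)] combine into the
    pairing with [w - grad f], and the rest is the Hessian of [f]. *)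
Lemma slice_second y (u v : 'rV[R]_n) : B y ->
  dotv ('D_u ('D_v X) y) (w - grad f (X y, t)) =
  dx ('D_u X y) (dx ('D_v X y) f) (X y, t).
Proof.
move=> By; have Ay := XA By.
have dX : is_derive y u ('D_v X) ('D_u ('D_v X) y).
  by apply: derivableP; apply: (CkS_derivable (Ck_derive _ Xk)).
have [_ e1] := is_derive_dotv w dX.
rewrite dotvBr -e1.
have -> : 'D_u (fun y => dotv ('D_v X y) w) y =
    'D_u (fun y => \sum_k 'D_v X y 0 k * dx (delta_mx 0 k) f (X y, t)) y.
  apply: near_eq_derive; near=> z.
  have Bz : B z by near: z; exact: open_nbhs_nbhs.
  by rewrite slice_tangent//; apply: eq_bigr => k _; rewrite mxE.
pose L k := fun y => 'D_v X y 0 k * dx (delta_mx 0 k) f (X y, t).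
have dL k : is_derive y u (L k) ('D_v X y 0 k * dx ('D_u X y) (dx (delta_mx 0 k) f) (X y, t) +
   dx (delta_mx 0 k) f (X y, t) * ('D_u ('D_v X) y) 0 k).
  apply: (@is_deriveM _ _ (fun y => 'D_v X y 0 k) (fun y => dx (delta_mx 0 k) f (X y, t))).
    have := is_derive_dotv (delta_mx 0 k) dX; rewrite dotv_delta.
    by under eq_fun do rewrite dotv_delta.
  exact: (is_derive_slice _ By (Ck_dx fk _)).
have [_] := is_derive_sum dL.
have -> : \sum_(i < n.+1) L i = (fun y => \sum_k 'D_v X y 0 k * dx (delta_mx 0 k) f (X y, t)).
  by apply/funext => z; rewrite fct_sumE.
move=> ->; rewrite big_split /= addrC.
have -> : \sum_i dx (delta_mx 0 i) f (X y, t) * ('D_u ('D_v X) y) 0 i =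
    dotv ('D_u ('D_v X) y) (grad f (X y, t)).
  by apply: eq_bigr => k _; rewrite mxE mulrC.
rewrite addrAC subrr add0r [in RHS](row_sum_delta ('D_v X y)).
pose H a b := dx a (dx b f) (X y, t).
have Hr a z z' z'' : H z (a *: z' + z'') = a * H z z' + H z z''.
  exact: (hess_linearr _ _ _ _ oA fk Ay).
exact: (esym (form_sumr Hr _ _ _ _)).
Unshelve. all: by end_near. Qed.

(* [w - p] is normal to the surface and pairs with [d_i d_j X] to the Hessian of
   [f] on the tangent vectors; the trace over the tangent space is the full trace
   minus the normal direction, in which [w] does not contribute. *)
Lemma slice_mean_curvature y : B y -> row_free (tangent_mx X y) ->
  let z := (X y, t) in let p := grad f z in
  dotv (mean_curvature_vector X y) (w - p) =
  \sum_k dx (delta_mx 0 k) (dx (delta_mx 0 k) f) z - dx p (dx p f) z / (1 + dotv p p).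
Proof.
move=> By Tfree z p; set N := w - p; have Az : A z := XA By.
have pw : dotv w p = 0 by rewrite -(dx_grad oA fk _ Az) fw.
have NN : dotv N N = 1 + dotv p p.
  by rewrite /N dotvBl !dotvBr w1 (dotvC p w) pw; ring.
have N0 : N != 0 by rewrite -dotv_eq0 NN gt_eqF// ltr_pwDl// dotv_ge0.
have rowT i : row i (tangent_mx X y) = 'D_(delta_mx 0 i) X y by rewrite rowK.
have TN : tangent_mx X y *m N^T = 0.
  apply/row_matrixP => i; rewrite row_mul rowT row0; apply/rowP => j.
  by rewrite ord1 -dotvE mxE dotvBr slice_tangent// subrr.
(* The tangential part is a combination of rows of the tangent matrix, all orthogonal to [N]. *)
have normN v : dotv (normal_part X y v) N = dotv v N.
  by rewrite /normal_part dotvBl [X in _ - X]dotvE -!mulmxA TN !mulmx0 mxE subr0.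
pose H a b := dx a (dx b f) z.
have Hl a u u' v : H (a *: u + u') v = a * H u v + H u' v by exact: (hess_linear _ _ _ _ oA fk Az).
have Hr a u v v' : H u (a *: v + v') = a * H u v + H u v' by exact: (hess_linearr _ _ _ _ oA fk Az).
have Hs u v : H u v = H v u by exact: (dx_comm oA fk).
have Hw u : H u w = 0.
  exact: (dx_local0 oA _ Az fw).
have HN : H N N = H p p.
  by rewrite /N -[w - p]addrC -scaleN1r Hl (Hs w) Hw addr0 Hr Hw; ring.
rewrite -NN -[dx p (dx p f) z]/(H p p) -HN.
rewrite -(tr_tangent Tfree TN N0 Hl Hr) /mean_curvature_vector /metric_mx.
rewrite [LHS]dotvC dotv_sumr; apply: eq_bigr => i _.
rewrite dotv_sumr; apply: eq_bigr => j _.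
rewrite dotvZr dotvC normN; congr (_ * _); rewrite !rowT.
exact: slice_second.
Qed.

End GraphSlice.

Lemma left_quotient_cvg (R : realType) (V : normedModType R) (g : R -> V) (t : R) (d : V) :
  is_derive t 1 g d -> (s - t)^-1 *: (g s - g t) @[s --> t^'-] --> d.
Proof.
move=> [dg <-].
have h : (fun h : R => h^-1 *: ((g \o shift t) (h *: 1) - g t)) @ 0^' --> 'D_1 g t by [].
have c : (s - t) @[s --> t^'-] --> (0 : R)^'.
  move=> B /nbhs_normP[e /= e0 eB].
  have : \forall s \near t^'-, s < t /\ t - s < e.
    by near=> s; split; near: s; [exact: nbhs_left_lt|exact: nbhs_left_ltBl].
  apply: filterS => s [st se]; apply: eB; last by rewrite subr_eq0 lt_eqF.
  by rewrite /ball_ /= sub0r opprB gtr0_norm// subr_gt0.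
have := cvg_comp _ _ c h; apply: cvg_trans; apply: near_eq_cvg.
by near=> s; rewrite /= [_ *: 1]mulr1 subrK.
Unshelve. all: by end_near. Qed.

Lemma left_derive_unique (R : realType) (V : normedModType R) (g h : R -> V) (t : R) (dg dh : V) :
  is_derive t 1 g dg -> is_derive t 1 h dh -> g t = h t ->
  (\forall s \near t^'-, g s = h s) -> dg = dh.
Proof.
move=> /left_quotient_cvg cg /left_quotient_cvg ch ght gh.
apply: (cvg_unique _ cg) => //.
apply: cvg_trans ch; apply: near_eq_cvg.
by near=> s; rewrite ght (near gh s).
Unshelve. all: by end_near. Qed.

(* [c] is defined on [0, T] only and [cx] is a differentiable extension of it near
   [t]; as [t] may be equal to [T], everything is compared through left
   difference quotients. *)
Lemma graph_time_derivative (R : realType) (m : nat) (f : 'rV[R]_m * R -> R)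
    (A : set ('rV[R]_m * R)) (w : 'rV[R]_m) (T t : R) (c cx : R -> 'rV[R]_m) (H d : 'rV[R]_m) :
  open A -> (forall k, Ck k A f) -> 0 < t -> t <= T -> A (c t, t) ->
  is_derive t 1 cx d ->
  (\forall s \near t, 0 <= s <= T -> cx s = c s /\ dotv (c s) w = f (c s, s)) ->
  (s - t)^-1 *: (c s - c t) @[s --> within [set s : R | 0 <= s <= T] t^'] --> H ->
  dt f (c t, t) = dotv H (w - grad f (c t, t)).
Proof.
move=> oA fk t0 tT At dcx ncx cH.
have t0T : 0 <= t <= T by rewrite ltW.
have [cxt gt] := nbhs_singleton ncx t0T.
have ncl : \forall s \near t^'-, cx s = c s /\ dotv (c s) w = f (c s, s).
  near=> s.
  have : 0 <= s <= T.
    apply/andP; split; first by near: s; exact: nbhs_left_ge.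
    by apply: le_trans tT; near: s; exact: nbhs_left_le.
  by near: s; apply: cvg_within ncx.
have dH : d = H.
  have cd := left_quotient_cvg dcx; apply: (cvg_unique _ cd) => //.
  apply: (@cvg_trans _ ((s - t)^-1 *: (c s - c t) @[s --> t^'-])).
    by apply: near_eq_cvg; near=> s; rewrite cxt (near ncl s _).1.
  apply: cvg_trans cH; apply: cvg_app => B.
  rewrite /within /= => BB.
  have : \forall s \near t^'-, s != t -> 0 <= s <= T -> B s by apply: cvg_within.
  apply: filter_app; near=> s; apply.
    by near: s; exact: nbhs_left_neq.
  apply/andP; split; first by near: s; exact: nbhs_left_ge.
  by apply: le_trans tT; near: s; exact: nbhs_left_le.
have d1 := is_derive_dotv w dcx.
have d2 : is_derive t 1 (f \o (fun s => (cx s, s))) (dotv d (grad f (c t, t)) + dt f (c t, t)).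
  have dp : is_derive t 1 (fun s => (cx s, s) : 'rV[R]_m * R) ((d, 1) : 'rV[R]_m * R).
    have [/derivable1_diffP dc dcE] := dcx.
    have dpd : differentiable (fun s => (cx s, s) : 'rV[R]_m * R) t by exact: differentiable_pair.
    split; first exact/derivable1_diffP.
    by rewrite deriveE// diff_pair//= diff_val -dcE deriveE.
  have Az : A (cx t, t) by rewrite cxt.
  have := is_derive_curve dp (spacetime_differentiable oA fk Az).
  by rewrite (derive_spacetime oA fk _ _ Az) mul1r (dx_grad oA fk _ Az) cxt.
have e : \forall s \near t^'-, dotv (cx s) w = (f \o (fun s0 : R => (cx s0, s0))) s.
  by apply: filterS ncl => s [e1 e2] /=; rewrite e1.
have := left_derive_unique d1 d2 _ e; rewrite /= cxt gt => /(_ erefl).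
by rewrite dotvBr -dH => ->; rewrite addrC addKr.
Unshelve. all: by end_near. Qed.

(** * Functions constant along the normal of the hyperplane *)

Section Cylinder.
Context {R : realType} {m : nat}.
Local Notation ST := ('rV[R]_m * R)%type.
Variable w : 'rV[R]_m.
Hypothesis w1 : dotv w w = 1.
Local Notation proj := (hyperplane_proj w).

Lemma proj_linear : linear proj.
Proof.
move=> a x y; rewrite /hyperplane_proj dotvDl dotvZl scalerDl scalerBr scalerA.
by rewrite opprD addrACA.
Qed.

Lemma proj_orth x : dotv (proj x) w = 0.
Proof. by rewrite dotvBl dotvZl w1 mulr1 subrr. Qed.

Lemma proj_id y : dotv y w = 0 -> proj y = y.
Proof. by move=> yw; rewrite /hyperplane_proj yw scale0r subr0. Qed.

Lemma proj_addw y a : dotv y w = 0 -> proj (y + a *: w) = y.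
Proof.
by move=> yw; rewrite /hyperplane_proj dotvDl dotvZl w1 yw add0r mulr1 addrK.
Qed.

Lemma dotv_proj x : dotv (proj x) (proj x) = dotv x x - dotv x w ^+ 2.
Proof.
rewrite /hyperplane_proj dotvBl !dotvBr !dotvZl !dotvZr w1 (dotvC w x); ring.
Qed.

Lemma continuous_proj : continuous proj.
Proof.
move=> x; have c1 : y @[y --> x] --> x by exact: cvg_id.
have c2 : dotv y w *: w @[y --> x] --> dotv x w *: w.
  have c3 : dotv y w @[y --> x] --> dotv x w := @continuous_dotv R m w x.
  exact: (cvg_comp _ _ c3 (@scalel_continuous _ _ w _)).
exact: (cvgB c1 c2).
Qed.

Definition cyl (z : ST) : ST := (proj z.1, z.2).

Lemma cyl_linear : linear cyl.
Proof. by move=> a x y; rewrite /cyl /= proj_linear. Qed.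

Lemma continuous_cyl : continuous cyl.
Proof.
move=> [x s].
have c1 : proj z.1 @[z --> (x, s)] --> proj x.
  exact: (cvg_comp _ _ (@cvg_fst _ _ (nbhs x) (nbhs s) _) (@continuous_proj x)).
exact: (cvg_pair c1 (@cvg_snd _ _ (nbhs x) (nbhs s) _)).
Qed.

(* [u] is only meaningful on the hyperplane orthogonal to [w].  Extended
   constantly along [w] (and, near the times [0] and [T], beyond [0, T]) it becomes
   a function [f] on an open set, so that ambient coordinates can be used. *)
Record cyl_ext (r T : R) (u : 'rV[R]_m -> R -> R) (A : set ST) (f : ST -> R) : Prop := CylExt {
  ext_open : open A;
  ext_Ck : forall k, Ck k A f;
  ext_ball : forall z, A z -> hyperplane_ball w r (proj z.1);
  ext_eq : forall z, A z -> 0 <= z.2 <= T -> f z = u (proj z.1) z.2;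
  ext_cyl : forall z z', cyl z = cyl z' -> A z -> A z';
  ext_inv : forall z z', cyl z = cyl z' -> f z = f z' }.

(** The local extension provided by [smooth_on] is precomposed with the linear map [cyl], and its
    domain is restricted to the points that project into the ball. *)
Lemma cyl_ext_exists (r T : R) (u : 'rV[R]_m -> R -> R) y t :
  smooth_on (hyperplane_ball w r `*` [set t : R | 0 <= t <= T])
            (fun z : 'rV[R]_m * R => u z.1 z.2 : R^o) ->
  hyperplane_ball w r y -> 0 <= t <= T ->
  exists A f, cyl_ext r T u A f /\ A (y, t).
Proof.
move=> su yb tT; have [U [g [oU Uy gk gu]]] := su (y, t) (conj yb tT).
pose L : {linear ST -> ST} := HB.pack cyl (GRing.isLinear.Build _ _ _ _ _ cyl_linear).
pose A : set ST := [set z | U (cyl z) /\ dotv (proj z.1) (proj z.1) < r ^+ 2].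
have py : cyl (y, t) = (y, t) by rewrite /cyl /= proj_id; [|exact: yb.1].
exists A, (fun z => g (cyl z)); split; last first.
  by split; [rewrite py|rewrite /= proj_id; [exact: yb.2|exact: yb.1]].
have oA : open A.
  apply: openI.
    by apply: open_comp => // z _; exact: continuous_cyl.
  have := @open_comp _ _ (fun z : ST => dotv (proj z.1) (proj z.1)) [set x | x < r ^+ 2].
  apply; last exact: open_lt.
  move=> [x s] _; have pz : proj z.1 @[z --> (x, s)] --> proj x.
    exact: (cvg_comp _ _ (@cvg_fst _ _ (nbhs x) (nbhs s) _) (@continuous_proj x)).
  exact: (cvg_dotv pz pz).
split=> //.
- move=> k; apply: (@Ck_subset _ _ _ [set z | U (L z + 0)]).
    by move=> z [Uz _]; rewrite /= addr0.
  have -> : (fun z => g (cyl z)) = (fun z => g (L z + 0)).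
    by apply/funext => z; rewrite addr0.
  by apply: Ck_comp_affine; [exact: continuous_cyl|exact: gk].
- by move=> z [_ zr]; split=> //; exact: proj_orth.
- by move=> z [Uz zr] zT; apply: gu => //; split=> //; split=> //; exact: proj_orth.
- by move=> z z' e; rewrite /A /= e; have [-> _] := e.
- by move=> z z' ->.
Qed.

(** [cyl] is linear, so shifting [z] and [z'] by the same vector keeps their images equal and the
    difference quotients coincide. *)
Lemma derive_cyl_inv (f : ST -> R) z z' v :
  (forall z z', cyl z = cyl z' -> f z = f z') -> cyl z = cyl z' -> 'D_v f z = 'D_v f z'.
Proof.
move=> fi e; rewrite /derive; set g1 := (X in X @ _); set g2 := (X in _ = lim (X @ _)).
suff -> : g1 = g2 by [].
apply/funext => h; rewrite /g1 /g2 /= (fi _ _ e) (fi (h *: v + z) (h *: v + z'))//.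
by rewrite !cyl_linear e.
Qed.

Section Ext.
Variables (r T : R) (u : 'rV[R]_m -> R -> R) (A : set ST) (f : ST -> R).
Hypothesis E : cyl_ext r T u A f.

Lemma ext_dxw z : dx w f z = 0.
Proof.
have e (h : R) : f (h *: ((w, 0) : ST) + z) = f z.
  apply: (ext_inv E); case: z => x s; rewrite /cyl /= scaler0 add0r addrC.
  congr pair; rewrite /hyperplane_proj dotvDl dotvZl w1 mulr1 scalerDl.
  by rewrite opprD addrACA subrr addr0.
rewrite -(@derive_cst R ST R (f z) z (w, 0)).
rewrite dx_def /derive; set g1 := (X in X @ _); set g2 := (X in _ = lim (X @ _)).
suff -> : g1 = g2 by [].
by apply/funext => h; rewrite /g1 /g2 /= e.
Qed.

End Ext.

End Cylinder.

(** * From the flow to the graph equation *)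

Section Flow.
Context {R : realType} {n : nat} {Mn : smooth_manifold R n}.
Local Notation ST := ('rV[R]_n.+1 * R)%type.
Variables (w : 'rV[R]_n.+1) (r T : R) (F : Mn -> R -> 'rV[R]_n.+1)
  (u : 'rV[R]_n.+1 -> R -> R).
Hypothesis w1 : dotv w w = 1.
Hypothesis F_mcf : smooth_mcf T F.
Hypothesis F_graph : graph_over_ball w r T F u.
Local Notation proj := (hyperplane_proj w).

Lemma on_graph p t : 0 <= t <= T -> hyperplane_ball w r (proj (F p t)) ->
  dotv (F p t) w = u (proj (F p t)) t.
Proof.
move=> tT pb; have [_ /(_ t tT) gE] := F_graph.
have : (range (fun p => F p t) `&` [set x | hyperplane_ball w r (proj x)]) (F p t).
  by split => //; exists p.
rewrite gE => -[y [yw yr] <-].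
by rewrite proj_addw// dotvDl dotvZl yw w1 add0r mulr1.
Qed.

Lemma graph_point y t : 0 <= t <= T -> hyperplane_ball w r y ->
  exists p, F p t = y + u y t *: w.
Proof.
move=> tT yb; have [_ /(_ t tT) gE] := F_graph.
have : [set y + u y t *: w | y in hyperplane_ball w r] (y + u y t *: w) by exists y.
by rewrite -gE => -[[p _ <-] _]; exists p.
Qed.

Variables (A : set ST) (f : ST -> R).
Hypothesis E : cyl_ext w r T u A f.

Lemma on_graph_ext p t : 0 <= t <= T -> A (F p t, t) -> dotv (F p t) w = f (F p t, t).
Proof.
move=> tT At; rewrite (on_graph tT (ext_ball E At)).
by rewrite (ext_eq E At).
Qed.

(** Supplies the hypotheses of the slice lemmas: freezing the time in a local extension of the flow
    is an affine substitution, and the result agrees with the flow on the image of the chart. *)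
Lemma flow_chart c p t : atlas c -> chart_dom c p -> 0 <= t <= T -> A (F p t, t) ->
  exists B : set 'rV[R]_n, [/\ open B, B (to_coord c p),
    forall k, Ck k B (in_chart c (fun p => F p t)) &
    forall y, B y -> A (in_chart c (fun p => F p t) y, t) /\
      dotv (in_chart c (fun p => F p t) y) w = f (in_chart c (fun p => F p t) y, t)].
Proof.
move=> ac cp tT At; set X := in_chart c _; set y0 := to_coord c p.
have [ochart oimg ofK _ _] := atlas_chart ac.
have [Fs _ _] := F_mcf.
have y0img : chart_img c y0 by exists p.
have [U [G [oU Uy Gk GF]]] := Fs c ac (y0, t) (conj y0img tT).
pose l := fun y : 'rV[R]_n => (y, 0) : 'rV[R]_n * R.
have slin : linear l by move=> a x y; congr pair; rewrite /= scaler0 addr0.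
pose L : {linear 'rV[R]_n -> ('rV[R]_n * R)%type} := HB.pack l (GRing.isLinear.Build _ _ _ _ _ slin).
have cL : continuous L.
  move=> y; exact: (cvg_pair (@cvg_id _ (nbhs y)) (@cvg_cst _ (0 : R) _ (nbhs y) _)).
have Lt y : L y + (0, t) = (y, t) by congr pair; rewrite /= ?addr0 ?add0r.
have Xk k : Ck k [set y | U (L y + (0, t))] (fun y => G (L y + (0, t))).
  by apply: Ck_comp_affine => //; exact: Gk.
have oV : open [set y | U (L y + (0, t))].
  apply: (@open_comp _ _ (fun y => L y + (0, t)) U) => // y _.
  have -> : (fun y => L y + (0, t)) = (fun y => (y, t)) by apply/funext.
  exact: (cvg_pair (@cvg_id _ (nbhs y)) (@cvg_cst _ t _ (nbhs y) _)).
have XG y : chart_img c y -> U (L y + (0, t)) -> G (L y + (0, t)) = X y.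
  by rewrite Lt => cy Uy'; rewrite GF.
have X0 : X y0 = F p t by rewrite /X /in_chart ofK.
have V0 : U (L y0 + (0, t)) by rewrite Lt.
pose S := [set y | U (L y + (0, t))] `&` chart_img c.
have oS : open S by exact: openI.
have Xk' k : Ck k S X.
  apply: (@Ck_local_eq _ _ _ S (fun y => G (L y + (0, t)))) => //.
    by move=> y [Vy cy]; exact: XG.
  by apply: Ck_subset (Xk k) => y [].
have cX : {for y0, continuous X} by exact: Ck_continuous Xk' _.
have nB : nbhs y0 (S `&` [set y | A (X y, t)]).
  apply: filterI; first exact: open_nbhs_nbhs.
  have c2 : (X y, t) @[y --> y0] --> (X y0, t).
    exact: (cvg_pair cX (@cvg_cst _ t _ (nbhs y0) _)).
  apply: (c2 A); apply: open_nbhs_nbhs; split; first exact: ext_open E.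
  by rewrite X0.
exists (interior (S `&` [set y | A (X y, t)])); split => //.
- exact: open_interior.
- by move=> k; apply: Ck_subset (Xk' k) => y /interior_subset[].
- move=> y /interior_subset[[_ cy] Ay]; split => //.
  exact: on_graph_ext.
Qed.

(** On the surface both sides equal the pairing of the mean curvature vector with [w - grad f]. Any
    other point of [A] is moved along [w] to the surface, which changes no derivative of [f]. *)
Lemma graph_flow_eq x t : 0 < t -> t <= T -> A (x, t) ->
  let p := grad f (x, t) in
  dt f (x, t) = \sum_k dx (delta_mx 0 k) (dx (delta_mx 0 k) f) (x, t) -
    dx p (dx p f) (x, t) / (1 + dotv p p).
Proof.
move=> t0 tT Ax.
have t0T : 0 <= t <= T by rewrite ltW.
have [p Fp] := graph_point t0T (ext_ball E Ax).
have ce : cyl w (x, t) = cyl w (F p t, t).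
  by rewrite /cyl /= Fp proj_addw// proj_orth.
have At : A (F p t, t) := ext_cyl E ce Ax.
have inv (h : ST -> R) v : (forall z z', cyl w z = cyl w z' -> h z = h z') ->
    forall z z', cyl w z = cyl w z' -> dx v h z = dx v h z'.
  move=> hinv z z' e; rewrite !dx_def; exact: (derive_cyl_inv _ hinv e).
have fi := ext_inv E.
have -> : grad f (x, t) = grad f (F p t, t).
  by apply/rowP => k; rewrite !mxE; exact: inv.
have -> : dt f (x, t) = dt f (F p t, t) by rewrite !dt_def; exact: (derive_cyl_inv _ fi ce).
move=> q; rewrite (inv _ _ (inv _ _ fi) _ _ ce).
under eq_bigr => k _ do rewrite (inv _ _ (inv _ _ fi) _ _ ce).
have [c ac cp] := atlas_cover p.
have [B [oB B0 Xk XB]] := flow_chart ac cp t0T At.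
have [_ imm Fd] := F_mcf.
have [_ _ ofK _ _] := atlas_chart ac.
have X0 : in_chart c (fun p => F p t) (to_coord c p) = F p t by rewrite /in_chart ofK.
have := slice_mean_curvature oB Xk (ext_open E) (ext_Ck E) (fun y By => (XB y By).1)
  (fun y By => (XB y By).2) w1 (fun z _ => ext_dxw w1 E z) B0 (imm t t0T c p ac cp).
rewrite X0 /= -/q => <-.
have [Fs _ _] := F_mcf.
have y0img : chart_img c (to_coord c p) by exists p.
have [U [G [oU Uy Gk GF]]] := Fs c ac (to_coord c p, t) (conj y0img t0T).
have cE : continuous (fun s => (to_coord c p, s) : 'rV[R]_n * R).
  move=> s; exact: (cvg_pair (@cvg_cst _ (to_coord c p) _ (nbhs s) _) (@cvg_id _ (nbhs s))).
have nU : \forall s \near t, U (to_coord c p, s).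
  by apply: (cE t U); exact: open_nbhs_nbhs.
have GFs s : U (to_coord c p, s) -> 0 <= s <= T -> G (to_coord c p, s) = F p s.
  by move=> Us sT; rewrite GF//= ofK.
have dG := is_derive_snd (CkS_derivable (v := ((0, 1) : 'rV[R]_n * R)) Gk Uy).
apply: (graph_time_derivative (ext_open E) (ext_Ck E) t0 tT At dG _ (Fd c p t ac cp t0T)).
have cG : G (to_coord c p, s) @[s --> t] --> F p t.
  rewrite -(GFs t Uy t0T).
  apply: (cvg_comp _ _ (cE t)); exact: (Ck_continuous Gk Uy).
have nA : \forall s \near t, A (G (to_coord c p, s), s).
  have c2 : (G (to_coord c p, s), s) @[s --> t] --> (F p t, t).
    exact: (cvg_pair cG (@cvg_id _ (nbhs t))).
  apply: (c2 A).
  by apply: open_nbhs_nbhs; split => //; exact: ext_open E.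
near=> s => sT.
have Us : U (to_coord c p, s) by near: s.
split; first exact: GFs.
by apply: on_graph_ext => //; rewrite -(GFs s Us sT); near: s.
Unshelve. all: by end_near. Qed.

(** The vector [w - q] is normal to the surface and has component [1] along [w]. Hence [nu] is
    [w - q] divided by its length, and the inverse of its own component along [w] is that length. *)
Lemma flow_normal p t nu : 0 <= t <= T -> A (F p t, t) ->
  upward_unit_normal w (fun p' => F p' t) p nu ->
  let q := grad f (F p t, t) in (dotv nu w)^-1 = Num.sqrt (1 + dotv q q).
Proof.
move=> tT At [nu1 nuw nuT] q.
have [c ac cp] := atlas_cover p.
have [B [oB B0 Xk XB]] := flow_chart ac cp tT At.
have [_ _ ofK _ _] := atlas_chart ac.
have X0 : in_chart c (fun p => F p t) (to_coord c p) = F p t by rewrite /in_chart ofK.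
have [_ imm _] := F_mcf.
have Tfree := imm t tT c p ac cp.
have tang v := slice_tangent oB Xk (ext_open E) (ext_Ck E) (fun y By => (XB y By).1)
  (fun y By => (XB y By).2) v B0.
pose N := w - q.
have qw : dotv w q = 0 by rewrite -(dx_grad (ext_open E) (ext_Ck E) _ At) (ext_dxw w1 E).
have NN : dotv N N = 1 + dotv q q.
  by rewrite /N dotvBl !dotvBr w1 (dotvC q w) qw; ring.
have NN0 : 0 < 1 + dotv q q by rewrite ltr_pwDl// dotv_ge0.
have N0 : N != 0 by rewrite -dotv_eq0 NN gt_eqF.
have TN : tangent_mx (in_chart c (fun p => F p t)) (to_coord c p) *m N^T = 0.
  apply/row_matrixP => i; rewrite row_mul rowK row0; apply/rowP => j.
  by rewrite ord1 -dotvE mxE dotvBr tang X0 subrr.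
have [e1 e2] := unit_normalE Tfree TN N0 (nuT c ac cp) nu1.
have := congr1 (dotv^~ w) e1; rewrite !dotvZl NN.
have -> : dotv N w = 1 by rewrite dotvBl w1 dotvC qw subr0.
rewrite mulr1 => e3.
have nuN0 : 0 < dotv nu N by rewrite -e3 mulr_gt0.
have -> : Num.sqrt (1 + dotv q q) = dotv nu N by rewrite -NN -e2 sqrtr_sqr gtr0_norm.
apply: (@mulfI _ (dotv nu w)); first by rewrite gt_eqF.
rewrite mulfV ?gt_eqF//; apply: (@mulfI _ (1 + dotv q q)); first by rewrite gt_eqF.
by rewrite mulr1 mulrA e3 -expr2 e2 NN.
Qed.

End Flow.

(** * The inequality at a maximum point *)

(** If [l] were positive, [g'] would be positive just to the right of [0], and the mean value
    theorem would make [g] exceed [g 0] there. *)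
Lemma local_max_derive (R : realType) (g g' : R -> R) (l e : R) : 0 < e ->
  (forall s : R, `|s| < e -> is_derive s 1 g (g' s)) -> is_derive (0 : R) 1 g' l ->
  (forall s : R, `|s| < e -> g s <= g 0) -> g' 0 = 0 /\ l <= 0.
Proof.
move=> e0 gd g'd gmax.
have z0 : (0 : R) \in `]-e, e[ by rewrite in_itv /= oppr_lt0 e0.
have inb (s : R) : s \in `]-e, e[ -> `|s| < e.
  by rewrite in_itv /= ltr_norml.
have g'0 : g' 0 = 0.
  have gd0 := gd 0 (inb _ z0).
  have mx : is_derive (0 : R) 1 g 0.
    apply: (@derive1_at_max _ _ (-e) e) => //.
    - by rewrite ltW// gtrN.
    - by move=> s /inb/gd gs; exact: ex_derive.
    - by move=> s /inb; exact: gmax.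
  by rewrite -(@derive_val _ _ _ _ _ _ _ gd0) (@derive_val _ _ _ _ _ _ _ mx).
split=> //; rewrite leNgt; apply/negP => l0.
have [dg' lE] := g'd.
have c : (fun h : R => h^-1 *: ((g' \o shift 0) (h *: 1) - g' 0)) @ 0^' --> l.
  by rewrite -lE; exact: dg'.
have nb : nbhs (0 : R) [set h : R | h != 0 -> 0 < h^-1 *: ((g' \o shift 0) (h *: 1) - g' 0)].
  exact: (cvgr_gt l c 0 l0).
have /nbhs_normP[d /= d0 dP] := nb.
have m0 : 0 < Num.min d e by rewrite lt_min d0 e0.
pose s := Num.min d e / 2.
have s0 : 0 < s by rewrite divr_gt0.
have sm : s < Num.min d e by rewrite ltr_pdivrMr// ltr_pMr// ltr1n.
have [sd se] : s < d /\ s < e by apply/andP; rewrite -lt_min.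
have ine x : 0 <= x -> x <= s -> `|x| < e.
  by move=> x0 xs; rewrite ger0_norm// (le_lt_trans xs).
have dgs x : x \in `]0, s[ -> is_derive x 1 g (g' x).
  by rewrite in_itv /= => /andP[/ltW x0 /ltW xs]; apply: gd; exact: ine.
have cg : {within `[0, s], continuous g}.
  apply: derivable_within_continuous => x; rewrite in_itv /= => /andP[x0 xs].
  have gx := gd x (ine x x0 xs); exact: ex_derive.
have [x xs gE] := MVT s0 dgs cg.
move: xs; rewrite in_itv /= => /andP[x0 xs].
have : 0 < g' x.
  have := dP x; rewrite /ball_ /= sub0r normrN gtr0_norm// (lt_trans xs sd) => /(_ isT).
  rewrite gt_eqF// => /(_ isT); rewrite addr0 g'0 subr0 [x *: 1]mulr1.
  by rewrite -[_ *: _]/(x^-1 * g' x) pmulr_rgt0// invr_gt0.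
move=> gx0; have := gmax s (ine s (ltW s0) (lexx _)).
by rewrite -subr_le0 gE subr0 leNgt mulr_gt0.
Qed.

(** Only times up to that of the maximum are compared, hence a sign instead of a vanishing
    derivative. *)
Lemma left_max_derive (R : realType) (g : R -> R) (t l : R) :
  is_derive t 1 g l -> (\forall s \near t^'-, g s <= g t) -> 0 <= l.
Proof.
move=> /left_quotient_cvg cg gmax; rewrite -(cvg_lim _ cg)//.
apply: limr_ge; first by apply/cvg_ex; exists l.
near=> s; have st : s < t by near: s; exact: nbhs_left_lt.
rewrite -[_ *: _]/((s - t)^-1 * (g s - g t)) mulr_le0//.
  by rewrite invr_le0 subr_le0 ltW.
by rewrite subr_le0; near: s.
Unshelve. all: by end_near. Qed.

Lemma is_derive_ln_comp (R : realType) (g : R -> R) (s dg : R) : 0 < g s ->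
  is_derive s 1 g dg -> is_derive s 1 (fun s => ln (g s)) (dg / g s).
Proof.
move=> g0 dgs; have h := is_derive1_ln g0.
by have := is_derive1_comp h dgs; rewrite mulrC.
Qed.

(** The barrier enters through its logarithm without the summand [ln t], which is constant along a
    spatial line; [K] stands for [2 * M]. *)
Lemma line_max_test (R : realType) (q e f q1 e1 f1 : R -> R) (q2 e2 f2 K t d : R) :
  0 < d -> 0 < t ->
  (forall s : R, `|s| < d -> [/\ 0 < q s, 0 < e s, is_derive s 1 q (q1 s),
     is_derive s 1 e (e1 s) & is_derive s 1 f (f1 s)]) ->
  is_derive (0 : R) 1 q1 q2 -> is_derive (0 : R) 1 e1 e2 -> is_derive (0 : R) 1 f1 f2 ->
  (forall s : R, `|s| < d -> ln (q s) + ln (e s) - (f s + K) ^+ 2 / (2 * t) <=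
     ln (q 0) + ln (e 0) - (f 0 + K) ^+ 2 / (2 * t)) ->
  q1 0 / q 0 + e1 0 / e 0 - (f 0 + K) / t * f1 0 = 0 /\
  q2 / q 0 - (q1 0 / q 0) ^+ 2 + e2 / e 0 - (e1 0 / e 0) ^+ 2
    - f1 0 ^+ 2 / t - (f 0 + K) / t * f2 <= 0.
Proof.
move=> d0 t0 H dq1 de1 df1 mx.
pose g := fun s => ln (q s) + ln (e s) - (f s + K) ^+ 2 / (2 * t).
pose g' := fun s => q1 s / q s + e1 s / e s - (f s + K) / t * f1 s.
have z0 : `|0 : R| < d by rewrite normr0.
have gd (s : R) : `|s| < d -> is_derive s 1 g (g' s).
  move=> /H[qs es dq de df].
  have h1 := is_derive_ln_comp qs dq; have h2 := is_derive_ln_comp es de.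
  have h3 : is_derive s 1 (fun s => (f s + K) ^+ 2 / (2 * t)) ((f s + K) / t * f1 s).
    have h4 : is_derive s 1 (fun s => f s + K) (f1 s).
      by have := is_deriveD df (is_derive_cst K s 1); rewrite addr0.
    have h5 := is_deriveM (is_deriveM h4 h4) (is_derive_cst (2 * t)^-1 s 1).
    apply: is_derive_eq h5 _.
    have sc (a b : R) : a *: b = a * b by [].
    by rewrite !fctE /= !sc; field; rewrite gt_eqF.
  exact: is_deriveB (is_deriveD h1 h2) h3.
have [q00 e00 dq de df] := H 0 z0.
have g'd : is_derive (0 : R) 1 g' (q2 / q 0 - (q1 0 / q 0) ^+ 2 + e2 / e 0 - (e1 0 / e 0) ^+ 2
    - f1 0 ^+ 2 / t - (f 0 + K) / t * f2).
  have qn : q 0 != 0 by rewrite gt_eqF.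
  have en : e 0 != 0 by rewrite gt_eqF.
  have h1 := is_deriveM dq1 (is_deriveV qn dq).
  have h2 := is_deriveM de1 (is_deriveV en de).
  have h4 : is_derive (0 : R) 1 (fun s => f s + K) (f1 0).
    by have := is_deriveD df (is_derive_cst K (0 : R) 1); rewrite addr0.
  have h5 := is_deriveM (is_deriveM h4 (is_derive_cst t^-1 (0 : R) 1)) df1.
  have h6 := is_deriveB (is_deriveD h1 h2) h5.
  apply: is_derive_eq h6 _.
  have sc (a b : R) : a *: b = a * b by [].
  by rewrite !fctE /= !sc; field; rewrite qn en gt_eqF.
have [e1' e2'] := local_max_derive d0 gd g'd mx.
by split.
Qed.

Lemma is_derive_bigsum (R : realType) (I : finType) (h : I -> R -> R) (dh : I -> R) (s : R) :
  (forall i, is_derive s 1 (h i) (dh i)) ->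
  is_derive s 1 (fun s => \sum_i h i s) (\sum_i dh i).
Proof.
move=> H; elim: (index_enum I) => [|i r IH].
  by under eq_fun do rewrite big_nil; rewrite big_nil; exact: is_derive_cst.
under eq_fun do rewrite big_cons; rewrite big_cons.
exact: is_deriveD.
Qed.

Lemma is_derive_quadratic (R : realType) (a b c s : R) :
  is_derive s 1 (fun s => a + b * s + c * s ^+ 2) (b + 2 * c * s).
Proof.
have h1 := is_deriveM (is_derive_cst b s 1) (is_derive_id s 1).
have h2 := is_deriveM (is_derive_cst c s 1) (is_deriveM (is_derive_id s 1) (is_derive_id s 1)).
have h3 := is_deriveD (is_deriveD (is_derive_cst a s 1) h1) h2.
apply: is_derive_eq h3 _.
have sc (x y : R) : x *: y = x * y by [].
by rewrite /= !sc; ring.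
Qed.

(** [V] is the slope at the maximum, [S] the shifted height, [yp] the pairing of position and
    gradient. Once [V >= 2], the second term outweighs the last one by [(S / t) ^+ 2 / 4], while the
    cross term with [yp] is at most [64 * S * r / M ^+ 4]. Thus [S * M ^+ 4 <= 256 * r * t ^+ 2],
    whereas [S >= M], [t <= 1] and [512 * r * t <= M ^+ 5] give the opposite. *)
Lemma barrier_contradiction (R : realFieldType) (M r t S V p2 yp eta phi : R) :
  0 < M -> 0 < r -> 0 < t -> t <= 1 -> 32 * r ^+ 2 * t <= M ^+ 4 ->
  512 * r * t <= M ^+ 5 -> M <= S -> 0 < V -> V ^+ 2 = 1 + p2 -> 0 <= p2 ->
  yp ^+ 2 <= r ^+ 2 * p2 -> 0 < eta -> eta <= r ^+ 2 ->
  M ^+ 4 / (16 * t) <= phi -> phi <= V * eta ->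
  0 <= - 4 * (S / (t * eta)) * (yp / V ^+ 2) - (S / t) ^+ 2 * (p2 / V ^+ 2)
    - 2 * (p2 / V ^+ 2) / eta + (p2 / V ^+ 2 - 1) / t + S ^+ 2 / (2 * t ^+ 2) -> False.
Proof.
move=> M0 r0 t0 t1 tr tM MS V0 V2 p20 yp2 eta0 etar phiM phiV HI.
have S0 : 0 < S by exact: lt_le_trans MS.
have V20 : 0 < V ^+ 2 by rewrite exprn_gt0.
have ypV : - yp <= r * V.
  have : yp ^+ 2 <= (r * V) ^+ 2.
    by rewrite exprMn V2 mulrDr mulr1 (le_trans yp2)// lerDr sqr_ge0.
  have rV : 0 < r * V by rewrite mulr_gt0.
  by move: (r * V) rV => b b0 h; rewrite leNgt; apply/negP => bb; nra.
(* The barrier is large and [V * eta] is at least as large; this controls the cross term, which has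
   [t * eta] in its denominator. *)
have W : M ^+ 4 <= 16 * (t * eta * V).
  move: phiM; rewrite ler_pdivrMr ?mulr_gt0// => /le_trans; apply.
  have -> : 16 * (t * eta * V) = V * eta * (16 * t) by ring.
  by rewrite ler_wpM2r// mulr_ge0// ltW.
(* From [W] and [eta <= r ^+ 2]; the [32] of the hypothesis is twice the [16] of the barrier
   bound. *)
have V_ge2 : 2 <= V.
  have : 32 * r ^+ 2 * t <= 16 * r ^+ 2 * t * V.
    rewrite (le_trans tr)// (le_trans W)//.
    have -> : 16 * r ^+ 2 * t * V = 16 * (t * r ^+ 2 * V) by ring.
    by rewrite ler_pM2l// ler_pM2r// ler_pM2l.
  have -> : 32 * r ^+ 2 * t = 16 * r ^+ 2 * t * 2 by ring.
  by rewrite ler_pM2l// !mulr_gt0// exprn_gt0.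
pose k := (V ^+ 2)^-1.
have k0 : 0 < k by rewrite invr_gt0.
have k4 : k <= 4^-1.
  by rewrite /k lef_pV2 ?posrE//; rewrite expr2; clear -V_ge2; nra.
have pk : p2 / V ^+ 2 = 1 - k.
  have e : p2 = V ^+ 2 - 1 by rewrite V2; ring.
  by rewrite /k e; field; rewrite gt_eqF.
have M40 : 0 < M ^+ 4 by rewrite exprn_gt0.
(* Bounding [- yp] by [r * V] leaves [t * eta * V] in the denominator, which [W] bounds from
   below. *)
have T1 : - 4 * (S / (t * eta)) * (yp / V ^+ 2) <= 64 * S * r / M ^+ 4.
  have -> : - 4 * (S / (t * eta)) * (yp / V ^+ 2) = 4 * (S / (t * eta)) * k * (- yp).
    by rewrite /k; field; rewrite !gt_eqF.
  apply: (@le_trans _ _ (4 * (S / (t * eta)) * k * (r * V))).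
    rewrite ler_wpM2l// ltW// !mulr_gt0// invr_gt0 mulr_gt0//.
  have -> : 4 * (S / (t * eta)) * k * (r * V) = 4 * S * r / (t * eta * V).
    by rewrite /k; field; rewrite !gt_eqF.
  have Q0 : 0 < t * eta * V by rewrite !mulr_gt0.
  rewrite ler_pdivlMr// mulrAC ler_pdivrMr//.
  have -> : 64 * S * r * (t * eta * V) = 4 * S * r * (16 * (t * eta * V)) by ring.
  by rewrite ler_wpM2l// ltW// !mulr_gt0.
have T2 : 0 <= 2 * (p2 / V ^+ 2) / eta.
  by apply: divr_ge0; [apply: mulr_ge0 => //; apply: divr_ge0 => //; exact: ltW|exact: ltW].
have T3 : (p2 / V ^+ 2 - 1) / t <= 0.
  by rewrite pk addrAC subrr add0r mulNr oppr_le0 ltW// divr_gt0.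
(* As [1 - k] is at least [3 / 4], a quarter of [(S / t) ^+ 2] is left over. *)
have T4 : S ^+ 2 / (2 * t ^+ 2) - (S / t) ^+ 2 * (p2 / V ^+ 2) <= - ((S / t) ^+ 2 / 4).
  rewrite pk; have -> : S ^+ 2 / (2 * t ^+ 2) = (S / t) ^+ 2 / 2 by field; rewrite gt_eqF.
  have : (S / t) ^+ 2 * k <= (S / t) ^+ 2 * 4^-1 by rewrite ler_wpM2l// sqr_ge0.
  by move: ((S / t) ^+ 2) (k) => z k'; clear; lra.
have F1 : (S / t) ^+ 2 / 4 <= 64 * S * r / M ^+ 4.
  by move: HI T1 T2 T3 T4; clear; lra.
move: F1; have -> : (S / t) ^+ 2 / 4 = S ^+ 2 / (4 * t ^+ 2) by field; rewrite gt_eqF.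
rewrite ler_pdivlMr// mulrAC ler_pdivrMr ?mulr_gt0 ?exprn_gt0//.
have -> : 64 * S * r * (4 * t ^+ 2) = S * (256 * r * t ^+ 2) by ring.
have -> : S ^+ 2 * M ^+ 4 = S * (S * M ^+ 4) by ring.
rewrite ler_pM2l//; apply/negP; rewrite -ltNge.
have h1 : 256 * r * t ^+ 2 <= 256 * r * t.
  apply: ler_wpM2l; first by rewrite mulr_ge0// ltW.
  rewrite expr2; apply: ler_piMl => //; exact: ltW.
have h2 : M ^+ 5 <= S * M ^+ 4 by rewrite exprS ler_wpM2r// ltW.
have h3 : 0 < M ^+ 5 by rewrite exprn_gt0.
by move: h1 h2 h3 tM; clear; lra.
Qed.

(** [P] and [H] are the gradient and the Hessian along a line, [g] and [K] their derivatives; this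
    linearises the graph operator in coordinates. *)
Lemma is_derive_graph_operator (R : realType) (m : nat) (P : 'I_m -> R -> R)
    (H : 'I_m -> 'I_m -> R -> R) (g : 'I_m -> R) (K : 'I_m -> 'I_m -> R) (s : R) :
  (forall k, is_derive s 1 (P k) (g k)) -> (forall k l, is_derive s 1 (H k l) (K k l)) ->
  let N := \sum_k \sum_l P k s * P l s * H k l s in
  let V := 1 + \sum_k P k s * P k s in
  is_derive s 1 (fun s => \sum_k H k k s -
      (\sum_k \sum_l P k s * P l s * H k l s) / (1 + \sum_k P k s * P k s))
    (\sum_k K k k - (\sum_k \sum_l (P k s * P l s * K k l +
       (P k s * g l + g k * P l s) * H k l s)) / V + N * (2 * \sum_k P k s * g k) / V ^+ 2).
Proof.
move=> dP dH N V.
have sc (a b : R) : a *: b = a * b by [].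
have D1 := is_derive_bigsum (fun k => dH k k).
have D2 : is_derive s 1 (fun s => \sum_k \sum_l P k s * P l s * H k l s)
    (\sum_k \sum_l (P k s * P l s * K k l + (P k s * g l + g k * P l s) * H k l s)).
  apply: is_derive_bigsum => k; apply: is_derive_bigsum => l.
  have h := is_deriveM (is_deriveM (dP k) (dP l)) (dH k l).
  by apply: is_derive_eq h _; rewrite !fctE !sc; ring.
have D3 : is_derive s 1 (fun s => 1 + \sum_k P k s * P k s) (2 * \sum_k P k s * g k).
  have h := is_deriveD (is_derive_cst (1 : R) s 1)
    (is_derive_bigsum (fun k => is_deriveM (dP k) (dP k))).
  apply: is_derive_eq h _; rewrite add0r mulr_sumr; apply: eq_bigr => k _.
  by rewrite !sc; ring.
have Vn : V != 0.
  by rewrite gt_eqF// ltr_pwDl// sumr_ge0// => k _; rewrite -expr2 sqr_ge0.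
pose W s := 1 + \sum_k P k s * P k s.
have h := is_deriveB D1 (is_deriveM D2 (is_deriveV (f := W) Vn D3)).
apply: is_derive_eq h _; rewrite /= !sc -/N -[W s]/V.
by field.
Qed.

Section GradientEquation.
Context {R : realType} {m : nat}.
Local Notation ST := ('rV[R]_m * R)%type.
Local Notation e k := (delta_mx 0 k : 'rV[R]_m).
Variables (A : set ST) (f : ST -> R) (x0 : 'rV[R]_m) (t0 : R).
Hypotheses (oA : open A) (fk : forall k, Ck k A f) (A0 : A (x0, t0)).
Hypothesis pde : forall x, A (x, t0) -> let p := grad f (x, t0) in
  dt f (x, t0) = \sum_k dx (e k) (dx (e k) f) (x, t0) -
    dx p (dx p f) (x, t0) / (1 + dotv p p).

Let p := grad f (x0, t0).
Let q := dx p f.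
Let g := grad q (x0, t0).

(* [q] is differentiated in the direction [p] frozen at [(x0, t0)], which avoids
   the second fundamental form that the evolution of [1 + |grad f|^2] contains. *)
Lemma frozen_gradient_equation :
  dt q (x0, t0) = \sum_k dx (e k) (dx (e k) q) (x0, t0) -
    dx p (dx p q) (x0, t0) / (1 + dotv p p) -
    2 * (dotv g g - dotv p g ^+ 2 / (1 + dotv p p)) / (1 + dotv p p).
Proof.
have qk : forall k, Ck k A q by exact: Ck_dx.
have nA : \forall s \near (0 : R), A (x0 + s *: p, t0).
  have c1 : continuous (fun s : R => x0 + s *: p).
    move=> s; have h1 : s' *: p @[s' --> s] --> s *: p := @scalel_continuous _ _ p s.
    exact: (cvgD (@cvg_cst _ x0 _ (nbhs s) _) h1).
  have c2 : (x0 + s *: p, t0) @[s --> (0 : R)] --> (x0 + 0 *: p, t0).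
    exact: (cvg_pair (c1 0) (@cvg_cst _ t0 _ (nbhs (0 : R)) _)).
  by apply: (c2 A); rewrite scale0r addr0; exact: open_nbhs_nbhs.
have A00 : A (x0 + 0 *: p, t0) by rewrite scale0r addr0.
have line (h : ST -> R) : (forall k, Ck k A h) ->
    is_derive (0 : R) 1 (fun s : R => h (x0 + s *: p, t0)) (dx p h (x0, t0)).
  by move=> hk; have := is_derive_dx hk A00; rewrite scale0r addr0.
have ck (k l : 'I_m) i : Ck i A (dx (e k) (dx (e l) f)) by apply: Ck_dx; exact: Ck_dx.
(* All derivatives commute, so the derivative in direction [p] of the Hessian of [f] is the Hessian
   of [q]. *)
have comm3 k l : dx p (dx (e k) (dx (e l) f)) (x0, t0) = dx (e k) (dx (e l) q) (x0, t0).
  apply: (etrans (dx_comm oA (Ck_dx fk (e l)) p (e k) A0)).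
  exact: (dx_local_eq oA (e k) A0 (fun z Az => dx_comm oA fk p (e l) Az)).
have gE k : dx p (dx (e k) f) (x0, t0) = g 0 k.
  rewrite mxE; exact: (dx_comm oA fk p (e k) A0).
pose H k l := dx (e k) (dx (e l) f) (x0, t0).
have pdeq x : A (x, t0) -> dt f (x, t0) = \sum_k dx (e k) (dx (e k) f) (x, t0) -
    (\sum_k \sum_l dx (e k) f (x, t0) * dx (e l) f (x, t0) * dx (e k) (dx (e l) f) (x, t0)) /
    (1 + \sum_k dx (e k) f (x, t0) * dx (e k) f (x, t0)).
  move=> Ax; rewrite (pde Ax) /=; set P := grad f (x, t0).
  pose B u v := dx u (dx v f) (x, t0).
  have Bl a u u' v : B (a *: u + u') v = a * B u v + B u' v by exact: (hess_linear _ _ _ _ oA fk Ax).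
  have Br a u v v' : B u (a *: v + v') = a * B u v + B u v' by exact: (hess_linearr _ _ _ _ oA fk Ax).
  have -> : dx P (dx P f) (x, t0) = \sum_k \sum_l dx (e k) f (x, t0) * dx (e l) f (x, t0) * dx (e k) (dx (e l) f) (x, t0).
    rewrite -[LHS]/(B P P) (form_expand Bl Br P P).
    by apply: eq_bigr => k _; apply: eq_bigr => l _; rewrite !mxE.
  congr (_ - _ / (1 + _)).
  by apply: eq_bigr => k _; rewrite !mxE.
pose z s : ST := (x0 + s *: p, t0).
have z0 : z 0 = (x0, t0) by rewrite /z scale0r addr0.
have dH k l : is_derive (0 : R) 1 (fun s => dx (e k) (dx (e l) f) (z s))
    (dx (e k) (dx (e l) q) (x0, t0)).
  by rewrite -comm3; exact: line (ck k l).
have dP k : is_derive (0 : R) 1 (fun s => dx (e k) f (z s)) (g 0 k).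
  by rewrite -gE; exact: line (Ck_dx fk (e k)).
have [_ D5] := is_derive_graph_operator dP dH.
have V20 : 1 + \sum_k dx (e k) f (z 0) * dx (e k) f (z 0) = 1 + dotv p p.
  by rewrite z0; congr (_ + _); apply: eq_bigr => k _; rewrite !mxE.
have V2n : 1 + dotv p p != 0 by rewrite gt_eqF// ltr_pwDl// dotv_ge0.
apply: (etrans (esym (dx_dt_comm oA fk p A0))).
have [_ <-] := line _ (Ck_dt fk).
pose Hf u v := dx u (dx v f) (x0, t0).
have Hl a u u' v : Hf (a *: u + u') v = a * Hf u v + Hf u' v by exact: (hess_linear _ _ _ _ oA fk A0).
have Hr a u v v' : Hf u (a *: v + v') = a * Hf u v + Hf u v' by exact: (hess_linearr _ _ _ _ oA fk A0).
pose Hq u v := dx u (dx v q) (x0, t0).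
have Hql a u u' v : Hq (a *: u + u') v = a * Hq u v + Hq u' v by exact: (hess_linear _ _ _ _ oA qk A0).
have Hqr a u v v' : Hq u (a *: v + v') = a * Hq u v + Hq u v' by exact: (hess_linearr _ _ _ _ oA qk A0).
(* Contracting the Hessian of [f] with [p] amounts to differentiating [q]. Since the coefficients at
   the point are built from the same [p], their derivatives can be written with [g] alone. *)
have Hfp v : Hf v p = dotv v g by exact: (dx_grad oA qk v A0).
have Hfp' v : Hf p v = dotv v g.
  by rewrite -Hfp; exact: (dx_comm oA fk).
apply: (@etrans _ _ ('D_1 (fun s => \sum_k dx (e k) (dx (e k) f) (z s) -
   (\sum_k \sum_l dx (e k) f (z s) * dx (e l) f (z s) * dx (e k) (dx (e l) f) (z s)) /
   (1 + \sum_k dx (e k) f (z s) * dx (e k) f (z s))) (0 : R))).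
  apply: near_eq_derive; near=> s; apply: pdeq.
  by near: s.
apply: (etrans D5).
have pE k : p 0 k = dx (e k) f (x0, t0) by rewrite mxE.
have N0 : \sum_k \sum_l dx (e k) f (z 0) * dx (e l) f (z 0) * dx (e k) (dx (e l) f) (z 0) = dotv p g.
  rewrite -(Hfp p) (form_expand Hl Hr p p) z0.
  by apply: eq_bigr => k _; apply: eq_bigr => l _; rewrite !mxE.
have N1 : \sum_k \sum_l (dx (e k) f (z 0) * dx (e l) f (z 0) * dx (e k) (dx (e l) q) (x0, t0) +
       (dx (e k) f (z 0) * g 0 l + g 0 k * dx (e l) f (z 0)) * dx (e k) (dx (e l) f) (z 0)) =
    Hq p p + 2 * dotv g g.
  transitivity (Hq p p + Hf p g + Hf g p); last by rewrite Hfp Hfp'; ring.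
  rewrite (form_expand Hql Hqr p p) (form_expand Hl Hr p g) (form_expand Hl Hr g p) z0.
  rewrite -!big_split; apply: eq_bigr => k _; rewrite -!big_split; apply: eq_bigr => l _ /=.
  by rewrite !pE mulrDl addrA.
have N2 : \sum_k dx (e k) f (z 0) * g 0 k = dotv p g.
  by rewrite z0; apply: eq_bigr => k _; rewrite pE.
rewrite N0 N1 N2 V20 -[dx p (dx p q) (x0, t0)]/(Hq p p).
by field.
Unshelve. all: by end_near. Qed.

End GradientEquation.

(** * The barrier and the logarithmic test function *)

Lemma sqrt_CS (R : realType) (m : nat) (p q : 'rV[R]_m) :
  1 + dotv p q <= Num.sqrt (1 + dotv p p) * Num.sqrt (1 + dotv q q).
Proof.
have P0 : 0 <= dotv p p by exact: dotv_ge0.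
have Q0 : 0 <= dotv q q by exact: dotv_ge0.
rewrite -sqrtrM ?addr_ge0//; apply: (le_trans (ler_norm _)); rewrite -sqrtr_sqr.
apply: ler_wsqrtr.
have h1 := dotv_CS p q; have := dotv_ge0 (p - q).
rewrite dotvBl !dotvBr (dotvC q p).
move: (dotv p p) (dotv q q) (dotv p q) P0 Q0 h1 => a b c; clear; nra.
Qed.

Definition barrier {R : realType} (M h t : R) : R := t * expR ((h + 2 * M) ^+ 2 / (2 * t)).

Lemma barrier_gt0 (R : realType) (M h t : R) : 0 < t -> 0 < barrier M h t.
Proof. by move=> t0; rewrite mulr_gt0// expR_gt0. Qed.

Lemma ln_barrier (R : realType) (M h t : R) : 0 < t ->
  ln (barrier M h t) = ln t + (h + 2 * M) ^+ 2 / (2 * t).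
Proof. by move=> t0; rewrite lnM ?posrE ?expR_gt0// expRK. Qed.

(** Squaring [expR x >= 1 + x] at half the exponent gives a bound of order [1 / t]. Applied to the
    whole exponent it would give a bound that stays finite as [t] tends to [0], and the blow-up
    would be lost. *)
Lemma barrier_ge (R : realType) (M h t : R) : 0 < t -> 0 < M -> M <= h + 2 * M ->
  M ^+ 4 / (16 * t) <= barrier M h t.
Proof.
move=> t0 M0 MS; pose S := h + 2 * M; rewrite /barrier -/S.
have S0 : 0 < S by exact: lt_le_trans MS.
have MS2 : M ^+ 2 <= S ^+ 2 by rewrite ler_sqr// nnegrE; exact: ltW.
have y0 : 0 <= M ^+ 2 / (4 * t) by rewrite divr_ge0 ?mulr_ge0 ?ltW ?exprn_ge0.
apply: (@le_trans _ _ (t * (M ^+ 2 / (4 * t)) ^+ 2)).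
  by rewrite le_eqVlt; apply/orP; left; apply/eqP; field; rewrite gt_eqF.
rewrite ler_pM2l//.
have -> : S ^+ 2 / (2 * t) = S ^+ 2 / (4 * t) + S ^+ 2 / (4 * t) by field; rewrite gt_eqF.
rewrite expRD -expr2 ler_sqr ?nnegrE ?expR_ge0//.
apply: (@le_trans _ _ (1 + S ^+ 2 / (4 * t))); last exact: expR_ge1Dx.
by rewrite ler_wpDl// ler_wpM2r// invr_ge0 mulr_ge0// ltW.
Qed.

(** Multiplying the comparison of quotients by [v0] trades the slope [v] for [Q <= v0 * v]; on the
    side of the maximum the factor becomes [v0 ^+ 2]. *)
Lemma ln_quotient_le (R : realType) (Q v v0 e e0 b b0 : R) :
  0 < Q -> Q <= v0 * v -> 0 < v0 -> 0 < e -> 0 < e0 -> 0 < b -> 0 < b0 ->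
  v * e / b <= v0 * e0 / b0 ->
  ln Q + ln e - ln b <= ln (v0 ^+ 2) + ln e0 - ln b0.
Proof.
move=> Q0 Qv v00 e_0 e00 b_0 b00 h.
have lnE (x y z : R) : 0 < x -> 0 < y -> 0 < z -> ln x + ln y - ln z = ln (x * y / z).
  by move=> x0 y0 z0; rewrite ln_div ?posrE ?mulr_gt0// lnM.
rewrite !lnE ?exprn_gt0// ler_ln ?posrE ?divr_gt0 ?mulr_gt0 ?exprn_gt0//.
apply: (@le_trans _ _ (v0 * v * e / b)).
  by rewrite ler_pM2r ?invr_gt0// ler_pM2r.
have -> : v0 * v * e / b = v0 * (v * e / b) by rewrite !mulrA.
have -> : v0 ^+ 2 * e0 / b0 = v0 * (v0 * e0 / b0) by rewrite expr2 !mulrA.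
by rewrite ler_pM2l.
Qed.

Lemma is_derive_time_test (R : realType) (q e f : R -> R) (dq de df K t : R) :
  0 < t -> 0 < q t -> 0 < e t ->
  is_derive t 1 q dq -> is_derive t 1 e de -> is_derive t 1 f df ->
  is_derive t 1 (fun s => ln (q s) + ln (e s) - (ln s + (f s + K) ^+ 2 / (2 * s)))
    (dq / q t + de / e t - t^-1 - (f t + K) / t * df + (f t + K) ^+ 2 / (2 * t ^+ 2)).
Proof.
move=> t0 q0 e0 dq' de' df'.
have sc (a b : R) : a *: b = a * b by [].
have d3 : is_derive t 1 (fun s => f s + K) df.
  by have := is_deriveD df' (is_derive_cst K t 1); rewrite addr0.
have d4 : is_derive t 1 (fun s => 2 * s) (2 : R).
  have := is_deriveM (is_derive_cst (2 : R) t 1) (is_derive_id t 1).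
  by rewrite scaler0 addr0 [_ *: 1]mulr1.
have t2 : 2 * t != 0 by rewrite mulf_neq0// gt_eqF.
have e1 := is_derive_ln_comp q0 dq'; have e2 := is_derive_ln_comp e0 de'.
have e3 := is_derive1_ln t0.
have e4 := is_deriveM (is_deriveM d3 d3) (is_deriveV (f := fun s : R => 2 * s) t2 d4).
apply: is_derive_eq (is_deriveB (is_deriveD e1 e2) (is_deriveD e3 e4)) _.
by rewrite !fctE /= !sc; field; rewrite !gt_eqF.
Qed.

Lemma line_test_numbers (R : realFieldType) (V G Y c eta k P t Q H V' G' eta' k' P' : R) :
  V' = V -> G' = G -> eta' = eta -> k' = k -> P' = P ->
  G' / V' + (- 2 * Y + 2 * (- c) * 0) / eta' - k' * P' = 0 /\
  Q / V' - (G' / V') ^+ 2 + (- 2 * c) / eta' - ((- 2 * Y + 2 * (- c) * 0) / eta') ^+ 2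
    - P' ^+ 2 / t - k' * H <= 0 ->
  G / V - 2 * Y / eta - k * P = 0 /\
  Q / V - (G / V) ^+ 2 - 2 * c / eta - (2 * Y / eta) ^+ 2 - P ^+ 2 / t - k * H <= 0.
Proof.
move=> -> -> -> -> ->; rewrite mulr0 addr0 !mulNr sqrrN => -[h1 h2].
by split; [rewrite -[RHS]h1|exact: h2].
Qed.

(** The tests in the directions of [form_tr_sqrt] add up to the trace against [1 - p p^T / V]. The
    form [B] collects all terms of the test, so that the trace is taken once. *)
Lemma traced_space_test (R : realType) (n : nat) (Hf Hq : 'rV[R]_n.+1 -> 'rV[R]_n.+1 -> R)
    (g p y w : 'rV[R]_n.+1) (eta t k : R) (V := 1 + dotv p p) :
  (forall a u u' v, Hf (a *: u + u') v = a * Hf u v + Hf u' v) ->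
  (forall a u v v', Hf u (a *: v + v') = a * Hf u v + Hf u v') ->
  (forall a u u' v, Hq (a *: u + u') v = a * Hq u v + Hq u' v) ->
  (forall a u v v', Hq u (a *: v + v') = a * Hq u v + Hq u v') ->
  dotv w w = 1 -> dotv p w = 0 ->
  (forall b, Hq b b / V - (dotv b g / V) ^+ 2 - 2 * (dotv b b - dotv b w ^+ 2) / eta
     - (2 * dotv y b / eta) ^+ 2 - dotv b p ^+ 2 / t - k * Hf b b <= 0) ->
  (\sum_i Hq (delta_mx 0 i) (delta_mx 0 i) - Hq p p / V) / V
    - (dotv g g - dotv p g ^+ 2 / V) / V ^+ 2
    - 2 * (n%:R - dotv p p / V) / eta
    - 4 * (dotv y y - dotv y p ^+ 2 / V) / eta ^+ 2
    - (dotv p p - dotv p p ^+ 2 / V) / t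
    - k * (\sum_i Hf (delta_mx 0 i) (delta_mx 0 i) - Hf p p / V) <= 0.
Proof.
move=> Hl Hr Hql Hqr w1 pw test.
have V0 : 0 < V by rewrite ltr_pwDl// dotv_ge0.
pose B u v := Hq u v / V - (dotv u g / V) * (dotv v g / V)
  - 2 * (dotv u v - dotv u w * dotv v w) / eta
  - (2 * dotv y u / eta) * (2 * dotv y v / eta) - dotv u p * dotv v p / t - k * Hf u v.
have Bl a u u' v : B (a *: u + u') v = a * B u v + B u' v.
  by rewrite /B Hl Hql !dotvDl !dotvZl dotvDr dotvZr; ring.
have Br a u v v' : B u (a *: v + v') = a * B u v + B u v'.
  by rewrite /B Hr Hqr !dotvDl !dotvZl !dotvDr !dotvZr; ring.
have Bneg u : B u u <= 0 by rewrite /B -!expr2; exact: test.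
pose s := Num.sqrt V.
have s0 : 0 < s by rewrite sqrtr_gt0.
have sV : s ^+ 2 = V by rewrite sqr_sqrtr// ltW.
(* With [s ^+ 2 = 1 + |p|^2] this solves the quadratic equation required by [form_tr_sqrt], in a
   form that does not divide by [|p|^2]. *)
pose th := (s * (s + 1))^-1.
have thE : 2 * th - th ^+ 2 * dotv p p = V^-1.
  have -> : dotv p p = s ^+ 2 - 1 by rewrite sV /V; ring.
  rewrite -sV /th; field.
  by rewrite !gt_eqF// addr_gt0.
have := form_tr_sqrt Bl Br thE.
set L := \sum_k _ => LE; have L0 : L <= 0 by apply: sumr_le0 => i _; exact: Bneg.
apply: le_trans L0; rewrite le_eqVlt; apply/orP; left; apply/eqP; rewrite LE.
have sq (x : 'rV[R]_n.+1) : \sum_i dotv (delta_mx 0 i) x ^+ 2 = dotv x x.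
  by apply: eq_bigr => i _; rewrite dotvC dotv_delta expr2.
have -> : \sum_i B (delta_mx 0 i) (delta_mx 0 i) =
    (\sum_i Hq (delta_mx 0 i) (delta_mx 0 i)) / V - dotv g g / V ^+ 2
    - 2 * n%:R / eta - 4 * dotv y y / eta ^+ 2 - dotv p p / t
    - k * (\sum_i Hf (delta_mx 0 i) (delta_mx 0 i)).
  (* The form [<u, v> - <u, w> <v, w>] has trace [n] over the [n + 1] ambient directions. *)
  have -> : n%:R = \sum_i (dotv (delta_mx 0 i) (delta_mx 0 i) - dotv (delta_mx 0 i) w ^+ 2) :> R.
    rewrite sumrB sq w1.
    under eq_bigr do rewrite dotv_delta mxE !eqxx.
    by rewrite sumr_const card_ord -natr1 addrK.
  rewrite -(sq g) -(sq y) -(sq p) !mulr_sumr !mulr_suml -!sumrB.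
  apply: eq_bigr => i _; rewrite /B (dotvC y).
  by rewrite !expr2 !invfM; ring.
rewrite /B pw (dotvC y p); move: V0 thE; clear.
move: (\sum_i _) (\sum_i _) => a b.
by move=> _ _; rewrite !expr2 !invfM; ring.
Qed.

(** [V] is here the square of the slope. The time test minus the traced test leaves one square of
    [g]; the first derivative tests, contracted with [g], [p] and the position, express all products
    with [g] through [p] and the position. *)
Lemma max_point_numbers (R : realFieldType) (n : nat)
    (V p2 yp yy gg pg yg t eta S ft qt Lf Lq : R) :
  0 < V -> V = 1 + p2 -> 0 < t -> 0 < eta ->
  gg / V - 2 * yg / eta - S / t * pg = 0 ->
  pg / V - 2 * yp / eta - S / t * p2 = 0 ->
  yg / V - 2 * yy / eta - S / t * yp = 0 ->
  ft = Lf -> qt = Lq - 2 * (gg - pg ^+ 2 / V) / V ->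
  Lq / V - (gg - pg ^+ 2 / V) / V ^+ 2 - 2 * (n%:R - p2 / V) / eta
    - 4 * (yy - yp ^+ 2 / V) / eta ^+ 2 - (p2 - p2 ^+ 2 / V) / t - S / t * Lf <= 0 ->
  0 <= qt / V - 2 * n%:R / eta - t^-1 - S / t * ft + S ^+ 2 / (2 * t ^+ 2) ->
  0 <= - 4 * (S / (t * eta)) * (yp / V) - (S / t) ^+ 2 * (p2 / V)
    - 2 * (p2 / V) / eta + (p2 / V - 1) / t + S ^+ 2 / (2 * t ^+ 2).
Proof.
move=> V0 Vp t0 eta0 h1 h2 h3 -> -> h4 h5.
have Vn : V != 0 by rewrite gt_eqF.
have tn : t != 0 by rewrite gt_eqF.
have en : eta != 0 by rewrite gt_eqF.
have pE : p2 = V - 1 by rewrite Vp; ring.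
have solve (x a b : R) : x / V - a - b = 0 -> x = V * (a + b).
  by move/eqP; rewrite -addrA -opprD subr_eq0 => /eqP <-; rewrite mulrC divfK.
rewrite (solve _ _ _ h1) (solve _ _ _ h3) (solve _ _ _ h2) in h4 h5.
move: (lerB h5 h4); rewrite subr0 => /le_trans; apply.
rewrite le_eqVlt; apply/orP; left; apply/eqP.
rewrite pE; field.
by rewrite Vn tn en.
Qed.

(** * Derivative tests at an interior maximum *)

Section MaximumPoint.
Context {R : realType} {n : nat}.
Local Notation ST := ('rV[R]_n.+1 * R)%type.
Local Notation e k := (delta_mx 0 k : 'rV[R]_n.+1).
Variables (A : set ST) (f : ST -> R) (w x0 : 'rV[R]_n.+1) (t0 M r : R).
Hypotheses (oA : open A) (fk : forall k, Ck k A f) (A0 : A (x0, t0)).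
Hypothesis pde : forall x, A (x, t0) -> let p := grad f (x, t0) in
  dt f (x, t0) = \sum_k dx (e k) (dx (e k) f) (x, t0) -
    dx p (dx p f) (x, t0) / (1 + dotv p p).
Hypotheses (w1 : dotv w w = 1) (fw : dx w f (x0, t0) = 0) (x0w : dotv x0 w = 0).
Hypothesis t0_gt0 : 0 < t0.

Local Notation proj := (hyperplane_proj w).
Local Notation z0 := ((x0, t0) : ST).

(** The projection makes it constant along [w], like the extended height. *)
Definition cutoff (z : ST) : R := r ^+ 2 - 2 * n%:R * z.2 - dotv (proj z.1) (proj z.1).
Local Notation slope z := (Num.sqrt (1 + dotv (grad f z) (grad f z))).

Hypothesis cutoff0 : 0 < cutoff z0.
Hypothesis max0 : \forall z \near z0, z.2 <= t0 ->
  slope z * cutoff z / barrier M (f z) z.2 <= slope z0 * cutoff z0 / barrier M (f z0) t0.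

Let p := grad f z0.
Let q := dx p f.
Let g := grad q z0.
Let V2 := 1 + dotv p p.

Lemma V2_gt0 : 0 < V2. Proof. by rewrite ltr_pwDl// dotv_ge0. Qed.

Lemma frozen_slope0 : q z0 = dotv p p. Proof. exact: (dx_grad oA fk _ A0). Qed.

Lemma continuous_cutoff : continuous cutoff.
Proof.
move=> [x s].
have pz : proj z.1 @[z --> (x, s)] --> proj x.
  exact: (cvg_comp _ _ (@cvg_fst _ _ (nbhs x) (nbhs s) _) (@continuous_proj _ _ w x)).
have c2 : r ^+ 2 - 2 * n%:R * z.2 @[z --> (x, s)] --> r ^+ 2 - 2 * n%:R * s.
  have c3 : 2 * n%:R * z.2 @[z --> (x, s)] --> 2 * n%:R * s.
    exact: (cvgM (@cvg_cst _ (2 * n%:R : R) _ (nbhs (x, s)) _) (@cvg_snd _ _ (nbhs x) (nbhs s) _)).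
  exact: (cvgB (@cvg_cst _ (r ^+ 2) _ (nbhs (x, s)) _) c3).
exact: (cvgB c2 (cvg_dotv pz pz)).
Qed.

Lemma near_pos : \forall z \near z0, [/\ A z, 0 < 1 + q z, 0 < cutoff z & 0 < z.2].
Proof.
have qk := Ck_dx fk p.
have cq : 1 + q z @[z --> z0] --> 1 + q z0.
  exact: (cvgD (@cvg_cst _ (1 : R) _ (nbhs z0) _) (Ck_continuous qk A0)).
have n1 : \forall z \near z0, 0 < 1 + q z.
  by apply: (cvgr_gt _ cq); rewrite frozen_slope0 V2_gt0.
have n2 : \forall z \near z0, 0 < cutoff z.
  exact: (cvgr_gt _ (continuous_cutoff (x:=z0)) 0 cutoff0).
have n3 : \forall z \near z0, 0 < z.2.
  exact: (cvgr_gt _ (@cvg_snd _ _ (nbhs x0) (nbhs t0) _) 0 t0_gt0).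
have n4 : \forall z \near z0, A z by exact: open_nbhs_nbhs.
by near=> z; split; near: z.
Unshelve. all: by end_near. Qed.

Lemma near_max : \forall z \near z0, [/\ A z, 0 < 1 + q z, 0 < cutoff z & 0 < z.2] /\
  (z.2 <= t0 ->
   ln (1 + q z) + ln (cutoff z) - (ln z.2 + (f z + 2 * M) ^+ 2 / (2 * z.2)) <=
   ln (1 + q z0) + ln (cutoff z0) - (ln t0 + (f z0 + 2 * M) ^+ 2 / (2 * t0))).
Proof.
have np := near_pos; near=> z.
have [Az Qz ez zt] : [/\ A z, 0 < 1 + q z, 0 < cutoff z & 0 < z.2] by near: z.
split => // zt0.
have mz : z.2 <= t0 -> slope z * cutoff z / barrier M (f z) z.2 <= slope z0 * cutoff z0 / barrier M (f z0) t0 by near: z.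
rewrite -!ln_barrier// frozen_slope0 -/V2 -[V2]sqr_sqrtr ?(ltW V2_gt0)//.
apply: (@ln_quotient_le _ _ (slope z)) => //; rewrite ?barrier_gt0 ?sqrtr_gt0 ?V2_gt0//.
  by rewrite /q (dx_grad oA fk _ Az); exact: sqrt_CS.
exact: mz.
Unshelve. all: by end_near. Qed.

Let S := f z0 + 2 * M.

(** [b] ranges over all ambient directions; its component along [w] does not change the cutoff,
    whence the correction [dotv b w ^+ 2]. *)
Lemma space_test b :
  dotv b g / V2 - 2 * dotv x0 b / cutoff z0 - S / t0 * dotv b p = 0 /\
  dx b (dx b q) z0 / V2 - (dotv b g / V2) ^+ 2
    - 2 * (dotv b b - dotv b w ^+ 2) / cutoff z0 - (2 * dotv x0 b / cutoff z0) ^+ 2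
    - dotv b p ^+ 2 / t0 - S / t0 * dx b (dx b f) z0 <= 0.
Proof.
have qk := Ck_dx fk p.
pose l s : ST := (x0 + s *: b, t0).
have l0 : l 0 = z0 by rewrite /l scale0r addr0.
have cl : l s @[s --> (0 : R)] --> l 0.
  have h1 : s' *: b @[s' --> (0 : R)] --> 0 *: b := @scalel_continuous _ _ b 0.
  have h2 : x0 + s *: b @[s --> (0 : R)] --> x0 + 0 *: b.
    exact: (cvgD (@cvg_cst _ x0 _ (nbhs (0 : R)) _) h1).
  exact: (cvg_pair h2 (@cvg_cst _ t0 _ (nbhs (0 : R)) _)).
have nl : nbhs (0 : R) [set s | [/\ A (l s), 0 < 1 + q (l s), 0 < cutoff (l s) & 0 < (l s).2] /\
  ((l s).2 <= t0 ->
   ln (1 + q (l s)) + ln (cutoff (l s)) - (ln (l s).2 + (f (l s) + 2 * M) ^+ 2 / (2 * (l s).2)) <=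
   ln (1 + q z0) + ln (cutoff z0) - (ln t0 + (f z0 + 2 * M) ^+ 2 / (2 * t0)))].
  by move: cl; rewrite l0 => cl; exact: (cl _ near_max).
have /nbhs_normP[d /= d0 dl] := nl.
have inb (s : R) : `|s| < d -> ball_ Num.Def.normr 0 d s by rewrite /ball_ /= sub0r normrN.
have A00 : A (l 0) by rewrite l0.
have lined (h : ST -> R) : (forall k, Ck k A h) ->
    is_derive (0 : R) 1 (fun s : R => h (l s)) (dx b h z0).
  by move=> hk; have := is_derive_dx hk A00; rewrite scale0r addr0.
set c2 := dotv b b - dotv b w ^+ 2.
have cutE s : cutoff (l s) = cutoff z0 + (- 2 * dotv x0 b) * s + (- c2) * s ^+ 2.
  rewrite /cutoff /= !dotv_proj// !dotvDl !dotvDr !dotvZl !dotvZr x0w (dotvC b x0) /c2; ring.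
have := @line_max_test R (fun s => 1 + q (l s)) (fun s => cutoff (l s)) (fun s => f (l s))
  (fun s => dx b q (l s)) (fun s => - 2 * dotv x0 b + 2 * (- c2) * s) (fun s => dx b f (l s))
  (dx b (dx b q) z0) (- 2 * c2) (dx b (dx b f) z0) (2 * M) t0 d d0 t0_gt0.
have H1 (s : R) : `|s| < d -> [/\ 0 < 1 + q (l s), 0 < cutoff (l s),
    is_derive s 1 (fun s => 1 + q (l s)) (dx b q (l s)),
    is_derive s 1 (fun s => cutoff (l s)) (- 2 * dotv x0 b + 2 * (- c2) * s) &
    is_derive s 1 (fun s => f (l s)) (dx b f (l s))].
  move=> /inb/dl[[As Qs es _] _]; split; [exact: Qs|exact: es| | |].
  - have := is_deriveD (is_derive_cst (1 : R) s 1) (is_derive_dx qk As).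
    by rewrite add0r.
  - have -> : (fun s => cutoff (l s)) = (fun s => cutoff z0 + (- 2 * dotv x0 b) * s + (- c2) * s ^+ 2).
      exact/funext.
    exact: is_derive_quadratic.
  - exact: is_derive_dx As.
have H2 : is_derive (0 : R) 1 (fun s => - 2 * dotv x0 b + 2 * (- c2) * s) (- 2 * c2).
  have -> : (fun s => - 2 * dotv x0 b + 2 * (- c2) * s) =
      (fun s => - 2 * dotv x0 b + (2 * (- c2)) * s + 0 * s ^+ 2).
    by apply/funext => s; rewrite mul0r addr0.
  apply: is_derive_eq (is_derive_quadratic _ _ _ _) _; ring.
have H3 (s : R) : `|s| < d ->
   ln (1 + q (l s)) + ln (cutoff (l s)) - (f (l s) + 2 * M) ^+ 2 / (2 * t0) <=
   ln (1 + q (l 0)) + ln (cutoff (l 0)) - (f (l 0) + 2 * M) ^+ 2 / (2 * t0).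
  move=> /inb/dl[_ /(_ (lexx _))]; rewrite l0 /=.
  by rewrite !opprD !addrA -!(addrAC _ (- (_ / _))) lerD2r.
move=> /(_ H1 (lined _ (Ck_dx qk b)) H2 (lined _ (Ck_dx fk b)) H3).
have eP : dx b f (l 0) = dotv b p by rewrite l0; exact: (dx_grad oA fk b A0).
have eG : dx b q (l 0) = dotv b g by rewrite l0; exact: (dx_grad oA qk b A0).
have eV : 1 + q (l 0) = V2 by rewrite l0 frozen_slope0.
have ee : cutoff (l 0) = cutoff z0 by rewrite l0.
have ek : (f (l 0) + 2 * M) / t0 = S / t0 by rewrite l0.
exact: (line_test_numbers eV eG ee ek eP).
Qed.

Lemma time_test : 0 <= dt q z0 / V2 - 2 * n%:R / cutoff z0 - t0^-1
  - S / t0 * dt f z0 + S ^+ 2 / (2 * t0 ^+ 2).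
Proof.
have qk := Ck_dx fk p.
have cl : continuous (fun s : R => (x0, s) : ST).
  by move=> s; exact: (cvg_pair (@cvg_cst _ x0 _ (nbhs s) _) (@cvg_id _ (nbhs s))).
pose h s := ln (1 + q (x0, s)) + ln (cutoff (x0, s)) - (ln s + (f (x0, s) + 2 * M) ^+ 2 / (2 * s)).
have nt : \forall s \near t0^'-, h s <= h t0.
  have : \forall s \near t0, s <= t0 -> h s <= h t0.
    have n0 : \forall s \near t0, [/\ A (x0, s), 0 < 1 + q (x0, s), 0 < cutoff (x0, s) & 0 < s] /\
        (s <= t0 -> h s <= h t0) := cl t0 _ near_max.
    by apply: filterS n0 => s [_]; exact.
  move=> nt; near=> s; have : s <= t0 by near: s; exact: nbhs_left_le.
  by near: s; apply: cvg_within nt.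
apply: (left_max_derive _ nt).
have sc (a b : R) : a *: b = a * b by [].
have cutE s : cutoff (x0, s) = (r ^+ 2 - dotv (proj x0) (proj x0)) + (- 2 * n%:R) * s + 0 * s ^+ 2.
  by rewrite /cutoff /=; ring.
have d1 : is_derive t0 1 (fun s => 1 + q (x0, s)) (dt q z0).
  by have := is_deriveD (is_derive_cst (1 : R) t0 1) (is_derive_dt qk A0); rewrite add0r.
have d2 : is_derive t0 1 (fun s => cutoff (x0, s)) (- 2 * n%:R).
  have -> : (fun s => cutoff (x0, s)) = (fun s => (r ^+ 2 - dotv (proj x0) (proj x0)) + (- 2 * n%:R) * s + 0 * s ^+ 2).
    exact/funext.
  by apply: is_derive_eq (is_derive_quadratic _ _ _ _) _; ring.
have eV : 1 + q (x0, t0) = V2 by rewrite frozen_slope0.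
have Q0 : 0 < 1 + q (x0, t0) by rewrite eV V2_gt0.
have := @is_derive_time_test R (fun s => 1 + q (x0, s)) (fun s => cutoff (x0, s))
  (fun s => f (x0, s)) _ _ _ (2 * M) t0 t0_gt0 Q0 cutoff0 d1 d2 (is_derive_dt fk A0).
move=> d5; apply: is_derive_eq d5 _.
by rewrite eV mulNr mulNr.
Unshelve. all: by end_near. Qed.

Let P2 := dotv p p.
Let YP := dotv x0 p.

Lemma max_point_inequality : 0 <= - 4 * (S / (t0 * cutoff z0)) * (YP / V2)
    - (S / t0) ^+ 2 * (P2 / V2) - 2 * (P2 / V2) / cutoff z0 + (P2 / V2 - 1) / t0
    + S ^+ 2 / (2 * t0 ^+ 2).
Proof.
have qk := Ck_dx fk p.
pose Hf u v := dx u (dx v f) z0; pose Hq u v := dx u (dx v q) z0.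
have Hl a u u' v : Hf (a *: u + u') v = a * Hf u v + Hf u' v by exact: (hess_linear _ _ _ _ oA fk A0).
have Hr a u v v' : Hf u (a *: v + v') = a * Hf u v + Hf u v' by exact: (hess_linearr _ _ _ _ oA fk A0).
have Hql a u u' v : Hq (a *: u + u') v = a * Hq u v + Hq u' v by exact: (hess_linear _ _ _ _ oA qk A0).
have Hqr a u v v' : Hq u (a *: v + v') = a * Hq u v + Hq u v' by exact: (hess_linearr _ _ _ _ oA qk A0).
have pw : dotv p w = 0 by rewrite dotvC -(dx_grad oA fk w A0).
have fot b := (space_test b).1.
have sst b := (space_test b).2.
have tst := traced_space_test Hl Hr Hql Hqr w1 pw sst.
have e1 : dt f z0 = \sum_i Hf (e i) (e i) - Hf p p / V2 := pde A0.
have e2 : dt q z0 = \sum_i Hq (e i) (e i) - Hq p p / V2 - 2 * (dotv g g - dotv p g ^+ 2 / V2) / V2.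
  exact: (frozen_gradient_equation oA fk A0 pde).
have tt := time_test.
have fg := fot g; rewrite (dotvC g p) in fg.
exact: (max_point_numbers V2_gt0 (erefl V2) t0_gt0 cutoff0 fg (fot p) (fot x0) e1 e2 tst tt).
Qed.

Lemma max_point_le : 0 < M -> 0 < r -> t0 <= 1 -> 32 * r ^+ 2 * t0 <= M ^+ 4 ->
  512 * r * t0 <= M ^+ 5 -> M <= f z0 + 2 * M ->
  slope z0 * cutoff z0 <= barrier M (f z0) t0.
Proof.
move=> M0 r0 t1 tr tM MS; rewrite leNgt; apply/negP => /ltW hb.
(* One inequality bounds both the position and the cutoff by [r ^+ 2]. *)
have x0r : dotv x0 x0 + cutoff z0 <= r ^+ 2.
  rewrite /cutoff /= dotv_proj// x0w expr0n subr0 addrC subrK gerBl.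
  by rewrite !mulr_ge0// ltW.
have x00 := dotv_ge0 x0.
have yp2 : YP ^+ 2 <= r ^+ 2 * P2.
  apply: (le_trans (dotv_CS _ _)); rewrite ler_wpM2r ?dotv_ge0//.
  by apply: le_trans x0r; rewrite lerDl ltW.
have er : cutoff z0 <= r ^+ 2 by apply: le_trans x0r; rewrite lerDr.
have sV : slope z0 ^+ 2 = 1 + P2 by rewrite sqr_sqrtr// ltW// V2_gt0.
have s0 : 0 < slope z0 by rewrite sqrtr_gt0 V2_gt0.
apply: (barrier_contradiction M0 r0 t0_gt0 t1 tr tM MS s0 sV (dotv_ge0 _) yp2 cutoff0 er
  (barrier_ge t0_gt0 M0 MS) hb).
by rewrite sV; exact: max_point_inequality.
Qed.

End MaximumPoint.

(** Boundedness refers to the sup norm: the square of each coordinate is at most [c], so its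
    absolute value is at most [1 + c]. *)
Lemma hyperplane_disc_compact (R : realType) (m : nat) (w : 'rV[R]_m) (c : R) :
  compact [set x : 'rV[R]_m | dotv x w = 0 /\ dotv x x <= c].
Proof.
apply: bounded_closed_compact.
  exists (1 + `|c|); split; first exact: num_real.
  move=> B cB x [_ xc]; rewrite /= /Num.Def.normr /= mx_normrE.
  apply: bigmax_le; first by rewrite (le_trans _ (ltW cB))// addr_ge0.
  move=> [i j] _ /=; rewrite (ord1 i).
  apply: le_trans (ltW cB).
  have h : x 0 j ^+ 2 <= c.
    apply: le_trans xc; rewrite /dotv (bigD1 j)//= -expr2 lerDl.
    by apply: sumr_ge0 => k _; rewrite -expr2 sqr_ge0.
  have c0 : 0 <= c by apply: le_trans h; rewrite sqr_ge0.
  rewrite (ger0_norm c0) -(ler_sqr (x := `|x 0 j|)) ?nnegrE ?addr_ge0// real_normK ?num_real//.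
  by apply: (le_trans h); clear -c0; nra.
have -> : [set x : 'rV[R]_m | dotv x w = 0 /\ dotv x x <= c] =
    (fun x => dotv x w) @^-1` [set y | y = 0] `&` (fun x => dotv x x) @^-1` [set y | y <= c] by [].
apply: closedI; apply: preimage_closed; [|exact: closed_eq| |exact: closed_le].
  by move=> x _; exact: continuous_dotv.
by move=> x _; exact: (cvg_dotv (@cvg_id _ (nbhs x)) (@cvg_id _ (nbhs x))).
Qed.

(** * The interior estimate *)

Section Slope.
Context {R : realType} {m : nat}.
Local Notation ST := ('rV[R]_m * R)%type.
Local Notation e k := (delta_mx 0 k : 'rV[R]_m).
Variables (w : 'rV[R]_m) (r T M : R) (u : 'rV[R]_m -> R -> R).
Hypothesis w1 : dotv w w = 1.
Local Notation proj := (hyperplane_proj w).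

(** Defined from [u] itself, so that the slope is one function on the whole disc, whereas the
    extensions [f] exist only locally. *)
Definition graph_grad (z : ST) : 'rV[R]_m := \row_k 'D_(e k) (fun x => u (proj x) z.2) z.1.

Definition graph_slope (z : ST) : R := Num.sqrt (1 + dotv (graph_grad z) (graph_grad z)).

Variables (A : set ST) (f : ST -> R).
Hypothesis E : cyl_ext w r T u A f.

Lemma graph_gradE z : A z -> 0 <= z.2 <= T -> graph_grad z = grad f z.
Proof.
case: z => x t /= Ax tT; apply/rowP => k; rewrite !mxE dx_def /=.
have -> : 'D_((e k, 0) : ST) f (x, t) = 'D_(e k) (fun x => f (x, t)) x.
  rewrite /derive; set g1 := (X in X @ _); set g2 := (X in _ = lim (X @ _)).
  suff -> : g1 = g2 by [].
  apply/funext => h; rewrite /g1 /g2 /=; congr (_ *: (f _ - _)).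
  by congr pair; rewrite /= scaler0 add0r.
apply/esym/near_eq_derive.
have cx : (x', t) @[x' --> x] --> (x, t).
  exact: (cvg_pair (@cvg_id _ (nbhs x)) (@cvg_cst _ t _ (nbhs x) _)).
have nA : \forall x' \near x, A (x', t).
  by apply: (cx A); apply: open_nbhs_nbhs; split => //; exact: ext_open E.
by near=> x'; rewrite (ext_eq E)//=; near: x'.
Unshelve. all: by end_near. Qed.

Lemma slope_cvg z : A z ->
  Num.sqrt (1 + dotv (grad f z') (grad f z')) @[z' --> z] --> Num.sqrt (1 + dotv (grad f z) (grad f z)).
Proof.
move=> Az.
have c1 : dotv (grad f z') (grad f z') @[z' --> z] --> dotv (grad f z) (grad f z).
  apply: cvg_big => [|k _]; first exact: add_continuous.
  have ck : grad f z' 0 k @[z' --> z] --> grad f z 0 k.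
    under eq_fun do rewrite mxE; rewrite mxE.
    exact: (Ck_continuous (Ck_dx (ext_Ck E) _) Az).
  exact: (cvgM ck ck).
have c2 : 1 + dotv (grad f z') (grad f z') @[z' --> z] --> 1 + dotv (grad f z) (grad f z).
  exact: (cvgD (@cvg_cst _ (1 : R) _ (nbhs z) _) c1).
exact: (cvg_comp _ _ c2 (@sqrt_continuous R _)).
Qed.

Lemma barrier_cvg z : A z -> 0 < z.2 ->
  barrier M (f z') z'.2 @[z' --> z] --> barrier M (f z) z.2.
Proof.
move=> Az zt.
have ct : z'.2 @[z' --> z] --> z.2.
  by case: z {Az zt} => x t; exact: (@cvg_snd _ _ (nbhs x) (nbhs t) _).
have cf : f z' + 2 * M @[z' --> z] --> f z + 2 * M.
  exact: (cvgD (Ck_continuous (ext_Ck E) Az) (@cvg_cst _ (2 * M) _ (nbhs z) _)).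
have c2t : 2 * z'.2 @[z' --> z] --> 2 * z.2.
  exact: (cvgM (@cvg_cst _ (2 : R) _ (nbhs z) _) ct).
have t2 : 2 * z.2 != 0 by rewrite mulf_neq0// gt_eqF.
have ce : (f z' + 2 * M) ^+ 2 / (2 * z'.2) @[z' --> z] --> (f z + 2 * M) ^+ 2 / (2 * z.2).
  exact: (cvgM (cvgM cf cf) (cvgV t2 c2t)).
exact: (cvgM ct (cvg_comp _ _ ce (@continuous_expR R _))).
Qed.

End Slope.

Lemma lt_of_double_le (R : realFieldType) (m c d : R) :
  0 < m -> d * (32 * c) <= m -> c * (16 * d) < m.
Proof. lra. Qed.

Lemma le_scaled (R : realFieldType) (k a s t m : R) :
  0 <= k -> 0 <= a -> s <= t -> k * a * t <= m -> k * a * s <= m.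
Proof. by move=> k0 a0 st; apply: le_trans; rewrite ler_wpM2l// mulr_ge0. Qed.

Section InteriorEstimate.
Context {R : realType} {n : nat} {Mn : smooth_manifold R n}.
Local Notation ST := ('rV[R]_n.+1 * R)%type.
Variables (w : 'rV[R]_n.+1) (r T M : R) (F : Mn -> R -> 'rV[R]_n.+1)
  (u : 'rV[R]_n.+1 -> R -> R).
Hypotheses (M_gt0 : 0 < M) (r_gt0 : 0 < r) (w1 : dotv w w = 1).
Hypothesis F_mcf : smooth_mcf T F.
Hypothesis F_graph : graph_over_ball w r T F u.
Hypothesis u_bound : forall y t, hyperplane_ball w r y -> 0 <= t <= T -> `|u y t| < M.
Local Notation proj := (hyperplane_proj w).
Local Notation disc rho := [set x : 'rV[R]_n.+1 | dotv x w = 0 /\ dotv x x <= rho ^+ 2].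
Local Notation slope := (graph_slope w u).
Local Notation ratio rho := (fun z : ST =>
  slope z * cutoff w rho z / barrier M (u z.1 z.2) z.2).

Lemma ext_at y t : hyperplane_ball w r y -> 0 <= t <= T ->
  exists A f, cyl_ext w r T u A f /\ A (y, t).
Proof. by move=> yb tT; apply: cyl_ext_exists => //; exact: F_graph.1. Qed.

Lemma disc_ball rho x : rho ^+ 2 < r ^+ 2 -> disc rho x -> hyperplane_ball w r x.
Proof. by move=> rr [xw xr]; split => //; exact: le_lt_trans rr. Qed.

(** A local extension is tied to [u] only at times in [[0, T]], so at the end times continuity is
    available only relative to [K]. *)
Lemma within_ext_cvg (h g : ST -> R) (K A : set ST) z : open A -> A z -> K z ->
  g z' @[z' --> z] --> g z -> (forall z', A z' -> K z' -> h z' = g z') ->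
  h @ within K (nbhs z) --> h z.
Proof.
move=> oA Az Kz gz hg; rewrite hg//.
have gw : g x @[x --> within K (nbhs z)] --> g z by apply: cvg_within_filter gz.
apply: cvg_trans gw; apply: near_eq_cvg.
rewrite near_withinE; near=> z' => Kz'; apply/esym; apply: hg => //.
by near: z'; exact: open_nbhs_nbhs.
Unshelve. all: by end_near. Qed.

(** By compactness; time [0] is included, which makes the bound uniform as the time tends to [0]. *)
Lemma slope_bounded rho b : rho ^+ 2 < r ^+ 2 -> 0 <= b -> b <= T ->
  exists2 C : R, 0 < C & forall x t, disc rho x -> 0 <= t <= b -> slope (x, t) <= C.
Proof.
move=> rr b0 bT; pose K : set ST := disc rho `*` `[0, b].
have tT t : 0 <= t <= b -> 0 <= t <= T by move=> /andP[-> /le_trans ->].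
have K0 : K !=set0.
  exists (0, 0); split => /=; last by rewrite in_itv /= lexx.
  by rewrite -(scale0r 0) !dotvZl !mul0r sqr_ge0.
have cK : compact K by apply: compact_setX; [exact: hyperplane_disc_compact|exact: segment_compact].
have cs z : K z -> slope @ within K (nbhs z) --> slope z.
  case: z => x t [/= xd]; rewrite in_itv /= => tb.
  have [A [f [E Az]]] := ext_at (disc_ball rr xd) (tT t tb).
  apply: (within_ext_cvg (ext_open E) Az _ (slope_cvg E Az)).
    by split => //=; rewrite in_itv.
  move=> z' Az' [_]; rewrite /= in_itv /= => zb.
  by rewrite /graph_slope (graph_gradE E)//; exact: tT.
have [c cK' cmax] := compact_EVT_max K0 cK ((subspace_continuousP _ _).2 cs).
exists (slope c).
  by rewrite sqrtr_gt0 ltr_pwDl// dotv_ge0.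
by move=> x t xd tb; apply: cmax; rewrite inE; split => //=; rewrite in_itv.
Qed.

Lemma ratio_max rho a b x1 t1 : rho ^+ 2 < r ^+ 2 -> 0 < a -> b <= T ->
  disc rho x1 -> a <= t1 <= b ->
  exists x0 t0, [/\ disc rho x0, a <= t0 <= b &
    forall x t, disc rho x -> a <= t <= b -> ratio rho (x, t) <= ratio rho (x0, t0)].
Proof.
move=> rr a0 bT x1d t1b; pose K : set ST := disc rho `*` `[a, b].
have tT t : a <= t <= b -> 0 <= t <= T.
  by move=> /andP[ha /le_trans ->//]; rewrite (le_trans (ltW a0)).
have K0 : K !=set0 by exists (x1, t1); split => //=; rewrite in_itv.
have cK : compact K by apply: compact_setX; [exact: hyperplane_disc_compact|exact: segment_compact].
have cs z : K z -> ratio rho @ within K (nbhs z) --> ratio rho z.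
  case: z => x t [/= xd]; rewrite in_itv /= => tb.
  have [A [f [E Az]]] := ext_at (disc_ball rr xd) (tT t tb).
  have t0 : 0 < (x, t).2 by case/andP: tb => + _; exact: lt_le_trans.
  have bn : barrier M (f (x, t)) t != 0 by rewrite gt_eqF// barrier_gt0.
  pose g z := Num.sqrt (1 + dotv (grad f z) (grad f z)) * cutoff w rho z / barrier M (f z) z.2.
  have cc : g z @[z --> (x, t)] --> g (x, t).
    exact: (cvgM (cvgM (slope_cvg E Az) (@continuous_cutoff R n w rho (x, t)))
      (cvgV bn (barrier_cvg E Az t0))).
  apply: (within_ext_cvg (ext_open E) Az _ cc).
    by split => //=; rewrite in_itv.
  move=> [x' t'] Az' [[/= xw _]]; rewrite in_itv /= => zb.
  rewrite /graph_slope (graph_gradE E)//; last exact: tT.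
  by rewrite /g (ext_eq E Az' (tT _ zb)) /= proj_id.
have [[x0 t0] cK' cmax] := compact_EVT_max K0 cK ((subspace_continuousP _ _).2 cs).
move: cK'; rewrite inE => -[/= xd]; rewrite in_itv /= => tb.
exists x0, t0; split => // x t xd' tb'; apply: (cmax (x, t)).
by rewrite inE; split => //=; rewrite in_itv.
Qed.

Lemma grad_cyl A f z z' : cyl_ext w r T u A f -> cyl w z = cyl w z' -> grad f z = grad f z'.
Proof.
move=> E e; apply/rowP => k; rewrite !mxE !dx_def.
exact: (derive_cyl_inv _ (ext_inv E) e).
Qed.

Lemma slope_gt0 z : 0 < slope z.
Proof. by rewrite sqrtr_gt0 ltr_pwDl// dotv_ge0. Qed.

(* [slope] is bounded up to time [0] on the closed disc and the barrier tends to
   infinity there, so the maximum over times in [d, t] is not attained at [d]. *)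
Lemma disc_estimate rho y t : 0 < rho -> rho ^+ 2 < r ^+ 2 -> disc rho y ->
  0 < t -> t <= T -> t <= 1 -> 32 * rho ^+ 2 * t <= M ^+ 4 -> 512 * rho * t <= M ^+ 5 ->
  slope (y, t) * cutoff w rho (y, t) <= barrier M (u y t) t.
Proof.
move=> rho0 rr yd t_gt0 tT t1 tr tM; rewrite leNgt; apply/negP => hb.
have [C C0 Cb] := slope_bounded rr (ltW t_gt0) tT.
(* At time [d] the barrier is at least [M ^+ 4 / (16 * d)], which exceeds the bound [C * rho ^+ 2]
   for slope times cutoff; [32] in place of [16] makes this strict. *)
pose d := Num.min t (M ^+ 4 / (32 * C * rho ^+ 2)).
have Cr : 0 < C * rho ^+ 2 by rewrite mulr_gt0// exprn_gt0.
have d0 : 0 < d.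
  by rewrite lt_min t_gt0 divr_gt0 ?exprn_gt0// -mulrA mulr_gt0.
have dt' : d <= t by rewrite ge_min lexx.
have dC : C * rho ^+ 2 < M ^+ 4 / (16 * d).
  have h : d * (32 * (C * rho ^+ 2)) <= M ^+ 4.
    by rewrite -ler_pdivlMr ?mulr_gt0// mulrA ge_min lexx orbT.
  have M4 : 0 < M ^+ 4 by rewrite exprn_gt0.
  rewrite ltr_pdivlMr ?mulr_gt0//.
  exact: lt_of_double_le M4 h.
have [|x0 [t0 [x0d t0d mx]]] := ratio_max (a := d) (b := t) (t1 := t) rr d0 tT yd.
  by rewrite dt' lexx.
have tT' s : d <= s <= t -> 0 <= s <= T.
  by move=> /andP[h /le_trans ->//]; rewrite (le_trans (ltW d0)).
have [dt0 t0t] := andP t0d.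
have t0_gt0 : 0 < t0 := lt_le_trans d0 dt0.
have r1 : 1 < ratio rho (x0, t0).
  apply: (@lt_le_trans _ _ (ratio rho (y, t))); last by apply: mx => //; rewrite dt' lexx.
  by rewrite /= ltr_pdivlMr ?barrier_gt0// mul1r.
have b0 h : 0 < barrier M h t0 by exact: barrier_gt0.
have c0 : 0 < cutoff w rho (x0, t0).
  have : 0 < ratio rho (x0, t0) := lt_trans ltr01 r1.
  by rewrite /= pmulr_lgt0 ?invr_gt0// pmulr_rgt0// slope_gt0.
have [x0w x0r] := x0d.
have x0b := disc_ball rr x0d.
have t0T := tT' _ t0d.
have MS s x : hyperplane_ball w r x -> 0 <= s <= T -> M <= u x s + 2 * M.
  move=> xb sT; have := u_bound xb sT; rewrite ltr_norml => /andP[h _].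
  by rewrite mulr2n mulrDl mul1r addrA lerDr -[M in _ + M]opprK subr_ge0 ltW.
have dt0' : d < t0.
  rewrite lt_neqAle dt0 andbT; apply/eqP => e.
  have : slope (x0, t0) * cutoff w rho (x0, t0) <= C * rho ^+ 2.
    apply: ler_pM; [exact/ltW/slope_gt0|exact: ltW| |].
      by apply: Cb => //; rewrite (ltW t0_gt0) t0t.
    by rewrite /cutoff /= -addrA gerDl -opprD oppr_le0 addr_ge0 ?dotv_ge0// !mulr_ge0// ltW.
  move: r1; rewrite /= ltr_pdivlMr// mul1r => /lt_le_trans h /h {}h.
  have := lt_trans h dC; rewrite e ltNge => /negP; apply.
  exact: barrier_ge (MS _ _ x0b t0T).
have [A [f [E A0]]] := ext_at x0b t0T.
have f0 : f (x0, t0) = u x0 t0 by rewrite (ext_eq E A0)//= proj_id.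
have slopeE z : A z -> 0 <= z.2 <= T -> slope z = Num.sqrt (1 + dotv (grad f z) (grad f z)).
  by move=> Az zT; rewrite /graph_slope (graph_gradE E).
have near_mx : \forall z \near (x0, t0), z.2 <= t0 ->
    Num.sqrt (1 + dotv (grad f z) (grad f z)) * cutoff w rho z / barrier M (f z) z.2 <=
    Num.sqrt (1 + dotv (grad f (x0, t0)) (grad f (x0, t0))) * cutoff w rho (x0, t0) / barrier M (f (x0, t0)) t0.
  have n1 : \forall z \near (x0, t0), A z by apply: open_nbhs_nbhs; split => //; exact: ext_open E.
  have n2 : \forall z \near (x0, t0), 0 < cutoff w rho z.
    exact: (cvgr_gt _ (@continuous_cutoff R n w rho (x0, t0)) 0 c0).
  have n3 : \forall z \near (x0, t0), d < z.2.
    exact: (cvgr_gt _ (@cvg_snd _ _ (nbhs x0) (nbhs t0) _) d dt0').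
  near=> z => zt0.
  have Az : A z by near: z.
  have cz : 0 < cutoff w rho z by near: z.
  have dz : d < z.2 by near: z.
  have pw := proj_orth w1 z.1.
  (* A point near the maximum may lie off the hyperplane. Its projection has the same slope, height
     and cutoff, and lies in the disc because the cutoff is positive. *)
  have pz : disc rho (proj z.1).
    split => //; rewrite ltW//; move: cz; rewrite /cutoff subr_gt0 => /lt_le_trans; apply.
    by rewrite gerBl !mulr_ge0// (le_trans (ltW d0))// ltW.
  have zT : d <= z.2 <= t by rewrite ltW//= (le_trans zt0).
  have e : cyl w z = cyl w (proj z.1, z.2) by rewrite /cyl /= (proj_id pw).
  have Ac : A (proj z.1, z.2) := ext_cyl E e Az.
  rewrite (grad_cyl E e) (ext_eq E Az (tT' _ zT)) -(slopeE _ Ac (tT' _ zT)) -(slopeE _ A0 t0T) f0.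
  have -> : cutoff w rho z = cutoff w rho (proj z.1, z.2) by rewrite /cutoff /= (proj_id pw).
  exact: (mx (proj z.1) z.2 pz zT).
have fw : dx w f (x0, t0) = 0 := ext_dxw w1 E (x0, t0).
have le1 : t0 <= 1 := le_trans t0t t1.
have tr' := le_scaled (ler0n R 32) (exprn_ge0 2 (ltW rho0)) t0t tr.
have tM' := le_scaled (ler0n R 512) (ltW rho0) t0t tM.
have MS0 : M <= f (x0, t0) + 2 * M by rewrite f0; exact: MS.
have t0T' : t0 <= T by case/andP: t0T.
have pde x (Ax : A (x, t0)) := graph_flow_eq w1 F_mcf F_graph E t0_gt0 t0T' Ax.
have := max_point_le (ext_open E) (ext_Ck E) A0 pde w1 fw x0w t0_gt0 c0 near_mx M_gt0 rho0 le1 tr' tM' MS0.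
rewrite -(slopeE _ A0 t0T) f0 leNgt => /negP; apply.
by move: r1; rewrite /= ltr_pdivlMr// mul1r.
Unshelve. all: by end_near. Qed.

(* Smaller discs approximate the ball, near whose boundary [slope] need not be
   bounded. *)
Lemma interior_estimate y t : hyperplane_ball w r y ->
  0 < t -> t <= T -> t <= 1 -> 32 * r ^+ 2 * t <= M ^+ 4 -> 512 * r * t <= M ^+ 5 ->
  0 < cutoff w r (y, t) ->
  slope (y, t) * cutoff w r (y, t) <= barrier M (u y t) t.
Proof.
move=> [yw yr] t0 tT t1 tr tM c0; rewrite leNgt; apply/negP => hb.
have s0 := slope_gt0 (y, t).
set c := cutoff w r (y, t) in c0 hb *; set s := slope (y, t) in s0 hb *.
have cE : c = r ^+ 2 - 2 * n%:R * t - dotv y y by rewrite /c /cutoff /= proj_id.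
have nt : 0 <= 2 * n%:R * t by rewrite !mulr_ge0// ltW.
(* Half the minimum keeps [y] inside the smaller disc and preserves the failing inequality: lowering
   the cutoff by [d] costs [s * d], which is less than the excess. *)
pose d := Num.min c ((s * c - barrier M (u y t) t) / s) / 2.
have m0 : 0 < Num.min c ((s * c - barrier M (u y t) t) / s).
  by rewrite lt_min c0 divr_gt0// subr_gt0.
have d0 : 0 < d by rewrite divr_gt0.
have [d1 d2] : d < c /\ d < (s * c - barrier M (u y t) t) / s.
  by apply/andP; rewrite -lt_min /d ltr_pdivrMr// ltr_pMr// ltr1n.
have yy := dotv_ge0 y.
have dr : d < r ^+ 2 by rewrite (lt_le_trans d1)// cE -addrA gerDl -opprD oppr_le0 addr_ge0.
pose rho := Num.sqrt (r ^+ 2 - d).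
have rho2 : rho ^+ 2 = r ^+ 2 - d by rewrite sqr_sqrtr// subr_ge0 ltW.
have rho0 : 0 < rho by rewrite sqrtr_gt0 subr_gt0.
have rr : rho ^+ 2 < r ^+ 2 by rewrite rho2 gtrBl.
have rhor : rho <= r by rewrite -(ler_sqr (x := rho)) ?nnegrE ?ltW.
have yd : disc rho y.
  split => //; rewrite rho2 lerBrDr -lerBrDl (le_trans (ltW d1))// cE.
  by rewrite lerD2r gerBl.
have := disc_estimate rho0 rr yd t0 tT t1.
have -> : cutoff w rho (y, t) = c - d by rewrite cE /cutoff /= proj_id// rho2; ring.
have tr' : 32 * rho ^+ 2 * t <= M ^+ 4.
  rewrite mulrAC; rewrite mulrAC in tr.
  exact: (le_scaled (ler0n R 32) (ltW t0) (ltW rr) tr).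
have tM' : 512 * rho * t <= M ^+ 5.
  rewrite mulrAC; rewrite mulrAC in tM.
  exact: (le_scaled (ler0n R 512) (ltW t0) rhor tM).
move=> /(_ tr' tM'); rewrite -/s leNgt => /negP; apply.
by move: d2; rewrite ltr_pdivlMr// (mulrC d) => h; rewrite mulrBr ltrBrDr addrC -ltrBrDr.
Qed.

End InteriorEstimate.

(** * The constants and the estimate on the surface *)

Unset Implicit Arguments.

Theorem theorem9p3 (R : realType) (M r : R) (M_gt0 : 0 < M) (r_gt0 : 0 < r) :
  exists q c T' : R, [/\ 1 < q, 0 < c, 0 < T' &
    forall (n : nat) (w : 'rV[R]_n.+1) (Mn : smooth_manifold R n) (T : R)
        (F : Mn -> R -> 'rV[R]_n.+1) (u : 'rV[R]_n.+1 -> R -> R),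
      (1 <= n)%N -> dotv w w = 1 -> 0 < T ->
      smooth_mcf T F ->
      graph_over_ball w r T F u ->
      (forall (y : 'rV[R]_n.+1) (t : R), hyperplane_ball w r y -> 0 <= t <= T -> `|u y t| < M) ->
      forall (p : Mn) (t : R) (nu : 'rV[R]_n.+1),
        0 < t -> t <= T' -> t <= T ->
        upward_unit_normal w (fun p' => F p' t) p nu ->
        let x := F p t in
        let h := dotv x w in
        let eta := r ^+ 2 - 2 * n%:R * t - dotv x x + h ^+ 2 in
        0 < eta ->
        (dotv nu w)^-1 <=
          t `^ (q / 2) * expR (c * q * (h + 2 * M) ^+ 2 / (4 * t)) * eta^-1].
Proof.
(* The three bounds are the smallness conditions of [barrier_contradiction]: the first quotient
   forces the slope to be at least [2] at the maximum, and the second, together with [t <= 1],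
   defeats the cross term. *)
pose T' : R := Num.min 1 (Num.min (M ^+ 4 / (32 * r ^+ 2)) (M ^+ 5 / (512 * r))).
have M4 : 0 < M ^+ 4 by rewrite exprn_gt0.
have M5 : 0 < M ^+ 5 by rewrite exprn_gt0.
have r32 : 0 < 32 * r ^+ 2 := mulr_gt0 (ltr0Sn R 31) (exprn_gt0 2 r_gt0).
have r512 : 0 < 512 * r := mulr_gt0 (ltr0Sn R 511) r_gt0.
have T'0 : 0 < T' by rewrite !lt_min ltr01 (divr_gt0 M4 r32) (divr_gt0 M5 r512).
exists 2, 1, T'; split; [by rewrite ltr1n|exact: ltr01|exact: T'0|].
move=> n w Mn T F u _ w1 _ F_mcf F_graph u_bound p t nu t0 tT' tT nuP x h eta eta0.
move: tT'; rewrite !le_min (ler_pdivlMr _ _ r32) (ler_pdivlMr _ _ r512) !(mulrC t) => /and3P[t1 tr tM].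
have t0T : 0 <= t <= T by rewrite ltW.
pose y := hyperplane_proj w x.
have yw : dotv y w = 0 by exact: proj_orth.
have yy : dotv y y = dotv x x - h ^+ 2 by exact: dotv_proj.
have cE : cutoff w r (y, t) = eta by rewrite /cutoff /= proj_id// yy opprB addrA addrAC.
have yb : hyperplane_ball w r y.
  split => //; rewrite -subr_gt0; apply: lt_le_trans eta0 _.
  by rewrite -cE /cutoff /= proj_id// lerD2r gerBl !mulr_ge0// ltW.
have hu : h = u y t := on_graph w1 F_graph t0T yb.
have [A [f [E Ay]]] := ext_at w1 F_graph yb t0T.
have ce : cyl w (y, t) = cyl w (x, t) by rewrite /cyl /= proj_id.
have Ax : A (x, t) := ext_cyl E ce Ay.
rewrite (flow_normal w1 F_mcf F_graph E t0T Ax nuP) -(grad_cyl E ce) -(graph_gradE E Ay t0T).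
have c0 : 0 < cutoff w r (y, t) by rewrite cE.
have := interior_estimate M_gt0 r_gt0 w1 F_mcf F_graph u_bound yb t0 tT t1 tr tM c0.
rewrite cE -hu => est; rewrite ler_pdivlMr//; apply: (le_trans est).
(* For [q = 2] and [c = 1] the power of [t] and the exponential are exactly the barrier. *)
rewrite /barrier divff// (powRr1 (ltW t0)) mul1r.
have -> : 2 * (h + 2 * M) ^+ 2 / (4 * t) = (h + 2 * M) ^+ 2 / (2 * t) by field; rewrite gt_eqF.
by [].
Qed.
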